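(* Given a cellular automaton $f:S^{\mathbb Z}\to S^{\mathbb Z}$ (with $S$ a finite set, $f$ specified by a local rule), it is decidable whether $f$ is a slider. Likewise, given a cellular automaton $f:S^{\mathbb Z}\to S^{\mathbb Z}$, it is decidable whether $f$ is a sweeper.
   Context: $S^{\mathbb Z}$ carries the product topology; a cellular automaton (CA) is a continuous map $S^{\mathbb Z}\to S^{\mathbb Z}$ commuting with the shift $\sigma(x)_i=x_{i+1}$; equivalently $f(x)_i=f_{\mathrm{loc}}(x_{[i-r,i+r]})$ for some radius $r$ and local rule $f_{\mathrm{loc}}:S^{2r+1}\to S$. A block rule is a function $\chi:S^n\to S^n$ ($n\ge1$), not necessarily bijective. For $i\in\mathbb Z$, $\chi^i:S^{\mathbb Z}\to S^{\mathbb Z}$ applies $\chi$ at coordinate $i$: $\chi^i(x)_{[i,i+n)}=\chi(x_{[i,i+n)})$, and all other coordinates are unchanged. Here $[i,i+n)=\{i,i+1,\dots,i+n-1\}$. Define $\chi^{i+}(x)=\lim_{j\to\infty}\chi^{j}\circ\chi^{j-1}\circ\cdots\circ\chi^{i}(x)$ and, for a block rule $\xi$, $\xi^{i-}(x)=\lim_{j\to-\infty}\xi^{j}\circ\cdots\circ\xi^{i-2}\circ\xi^{i-1}(x)$; these limits always exist. Slider: if $\chi$ is a bijective block rule with inverse $\xi$, its slider relation is the set of pairs $(y,z)\in S^{\mathbb Z}\times S^{\mathbb Z}$ such that for some $x\in S^{\mathbb Z}$ and some $i\in\mathbb Z$, $\xi^{i-}(x)=y$ and $\chi^{i+}(x)=z$.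 A function $f:S^{\mathbb Z}\to S^{\mathbb Z}$ is a slider if its graph is the slider relation of some bijective block rule. Sweeper: if $\chi$ is a block rule (bijectivity is not required) such that for each $y\in S^{\mathbb Z}$ the limit $\lim_{i\to-\infty}\chi^{i+}(y)$ exists, then the function $y\mapsto\lim_{i\to-\infty}\chi^{i+}(y)$ is called the sweeper defined by $\chi$. A function $f:S^{\mathbb Z}\to S^{\mathbb Z}$ is a sweeper if it is the sweeper defined by some block rule. *)

(* Defs.v *)
From HB Require Import structures.
From mathcomp Require Import all_boot all_order all_algebra.
From mathcomp Require Import boolp classical_sets filter topology.
From mathcomp Require Import zify.

Set Implicit Arguments.
Unset Strict Implicit.
Unset Printing Implicit Defensive.

Import Order.TTheory GRing.Theory Num.Theory.

Local Open Scope classical_set_scope.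
Local Open Scope ring_scope.

(** * Configurations, cellular automata, sliders and sweepers *)

Definition config (S : Type) : Type :=
  prod_topology (fun _ : int => discrete_topology S).

Section Dynamics.
Variable S : finType.
Implicit Types (x y z : config S) (i j : int) (n r : nat).

(* The word x_[i, i + n). *)
Definition window n x i : n.-tuple S := [tuple (x (i + k%:Z) : S) | k < n].

Definition ca_map r (floc : (2 * r).+1.-tuple S -> S) : config S -> config S :=
  fun x i => floc (window (2 * r).+1 x (i - r%:Z)).

(* chi^i; the default value of [nth] is never used. *)
Definition block_at n (chi : n.-tuple S -> n.-tuple S) i x : config S :=
  fun j => if (i <= j) && (j < i + n%:Z)
           then nth (x j : S) (chi (window n x i)) `|j - i|%N
           else x j.

(* chi^(i+m-1) o ... o chi^(i+1) o chi^i *)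
Fixpoint rsteps n (chi : n.-tuple S -> n.-tuple S) i (m : nat) x : config S :=
  if m is m'.+1 then block_at chi (i + m'%:Z) (rsteps chi i m' x) else x.

(* xi^(i-m) o ... o xi^(i-2) o xi^(i-1) *)
Fixpoint lsteps n (xi : n.-tuple S -> n.-tuple S) i (m : nat) x : config S :=
  if m is m'.+1 then block_at xi (i - m%:Z) (lsteps xi i m' x) else x.

(* chi^(i+) and xi^(i-).  The library's [lim] needs a pointed space, whereas S
   may be empty: the junk value is x instead of a fixed point.  It is never
   taken, by [rsweep_cvg] and [lsweep_cvg] below. *)
Definition rsweep n (chi : n.-tuple S -> n.-tuple S) i x : config S :=
  xget x [set z : config S | (fun m => rsteps chi i m x) @ \oo --> z].

Definition lsweep n (xi : n.-tuple S -> n.-tuple S) i x : config S :=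
  xget x [set z : config S | (fun m => lsteps xi i m x) @ \oo --> z].

Definition slider_relation n (chi xi : n.-tuple S -> n.-tuple S) y z : Prop :=
  exists x i, lsweep xi i x = y /\ rsweep chi i x = z.

Definition is_slider (f : config S -> config S) : Prop :=
  exists n (chi xi : n.-tuple S -> n.-tuple S),
    [/\ (0 < n)%N, cancel chi xi, cancel xi chi
      & forall y z, f y = z <-> slider_relation chi xi y z].

Definition is_sweeper (f : config S -> config S) : Prop :=
  exists n (chi : n.-tuple S -> n.-tuple S),
    (0 < n)%N /\
    forall y, (fun m : nat => rsweep chi (- m%:Z) y) @ \oo --> f y.

End Dynamics.

(** * Computability *)

(* Partial recursive functions on nat.  Programs are not indexed by their
   arity: a program run on too few arguments has no value. *)
Inductive recfun : Type :=
| RZero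
| RSucc
| RProj (i : nat)
| RComp (f : recfun) (gs : seq recfun)
| RRec (f g : recfun)
| RMu (f : recfun).

(* [computes p s v]: the program p on arguments s halts with value v. *)
Inductive computes : recfun -> seq nat -> nat -> Prop :=
| computes_zero s : computes RZero s 0
| computes_succ n s : computes RSucc (n :: s) n.+1
| computes_proj i s : (i < size s)%N -> computes (RProj i) s (nth 0%N s i)
| computes_comp f gs s t v :
    size t = size gs ->
    (forall i, (i < size gs)%N -> computes (nth RZero gs i) s (nth 0%N t i)) ->
    computes f t v -> computes (RComp f gs) s v
| computes_rec0 f g s v : computes f s v -> computes (RRec f g) (0%N :: s) v
| computes_recS f g n s u v :
    computes (RRec f g) (n :: s) u -> computes g [:: n, u & s] v ->
    computes (RRec f g) (n.+1 :: s) v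
| computes_mu f s n (u : nat -> nat) :
    computes f (n :: s) 0 ->
    (forall m, (m < n)%N -> computes f (m :: s) (u m).+1) ->
    computes (RMu f) s n.

Lemma computes_fun p s v w : computes p s v -> computes p s w -> v = w.
Proof.
move=> pv; elim: pv w => {p s v}.
- by move=> s w H; inversion H.
- by move=> n s w H; inversion H.
- by move=> i s _ w H; inversion H.
- move=> f gs s t v szt _ IHg _ IHf w H; inversion H as [| | |? ? ? t' ? szt' Hg Hf| | |]; subst.
  suff tt' : t = t' by apply: IHf; rewrite tt'.
  apply: (@eq_from_nth _ 0%N); first by rewrite szt szt'.
  by move=> i; rewrite szt => lti; apply: IHg => //; apply: Hg.
- by move=> f g s v _ IH w H; inversion H; subst; apply: IH.
- move=> f g n s u v _ IHu _ IHv w H; inversion H as [| | | | |? ? ? ? u' ? Hu Hv|]; subst.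
  by apply: IHv; rewrite (IHu _ Hu).
- move=> f s n u _ IH0 _ IHm w H; inversion H as [| | | | | |? ? ? u' H0 Hm]; subst.
  case: (ltngtP n w) => // lt.
  + by have := IH0 _ (Hm _ lt).
  + by have := IHm _ lt _ H0.
Qed.

(* All words of length n, lexicographically for the order of [enum S]. *)
Fixpoint words (S : finType) (n : nat) : seq (n.-tuple S) :=
  if n is m.+1 then [seq cons_tuple a w | a <- enum S, w <- words S m]
  else [:: [tuple]].

(* The local rule as a finite object: the number of states, the radius, then the
   table of values, states being numbered by [enum_rank]. *)
Definition ca_code (S : finType) r (floc : (2 * r).+1.-tuple S -> S) : nat :=
  CodeSeq.code
    [:: #|S|, r & [seq nat_of_ord (enum_rank (floc w)) | w <- words S (2 * r).+1]].

Definition decidable_for_ca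
    (P : forall S : finType, (config S -> config S) -> Prop) : Prop :=
  exists d : recfun,
    forall (S : finType) (r : nat) (floc : (2 * r).+1.-tuple S -> S),
      (P S (ca_map floc) -> computes d [:: ca_code floc] 1) /\
      (~ P S (ca_map floc) -> computes d [:: ca_code floc] 0).

(** * The one-sided limits exist *)

Section LimitsExist.
Variable S : finType.
Implicit Types (x z : config S) (i j : int) (n : nat).

Lemma cvg_configP (u : nat -> config S) z :
  u @ \oo --> z <->
  forall j, exists N, forall m, (N <= m)%N -> u m j = z j.
Proof.
split=> [uz j|uz].
- have pj := @proj_continuous int (fun=> discrete_topology S) j z.
  have nz : nbhs z [set y : config S | y j = z j].
    exact: (pj _ (discrete_set1 (z j : discrete_topology S))).
  have [N _ uN] := uz _ nz.
  by exists N => m Nm; exact: (uN m Nm).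
- apply/cvg_sup => j A.
  rewrite (@nbhsE (initial_topology
    (fun f : int -> discrete_topology S => f j))) => -[_ [[B oB <-] Bz] BA].
  have [N uN] := uz j.
  by exists N => // m Nm; apply: BA; rewrite /preimage /= uN.
Qed.

Lemma cvg_config_unique (u : nat -> config S) z z' :
  u @ \oo --> z -> u @ \oo --> z' -> z = z'.
Proof.
move=> /cvg_configP uz /cvg_configP uz'; apply/funext => j.
have [N uN] := uz j; have [N' uN'] := uz' j.
by rewrite -(uN (maxn N N')) ?leq_maxl // uN' ?leq_maxr.
Qed.

Lemma stationary_cvg (u : nat -> config S) :
  (forall j, exists N, forall m, (N <= m)%N -> u m.+1 j = u m j) ->
  exists z, u @ \oo --> z.
Proof.
move=> /choice[N uN]; exists (fun j => u (N j) j).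
apply/cvg_configP => j; exists (N j) => m /subnK <-.
by elim: (m - N j)%N => // k IH; rewrite addSn uN ?leq_addl.
Qed.

Lemma rsweep_cvg n (chi : n.-tuple S -> n.-tuple S) i x :
  (fun m => rsteps chi i m x) @ \oo --> rsweep chi i x.
Proof.
apply: (@xgetPex _ x [set z | _ --> z]); apply: stationary_cvg => j.
exists `|j - i|.+1 => m /= hm; rewrite /block_at ifF //; apply/negbTE.
by rewrite negb_and -ltNge; apply/orP; left; lia.
Qed.

Lemma lsweep_cvg n (xi : n.-tuple S -> n.-tuple S) i x :
  (fun m => lsteps xi i m x) @ \oo --> lsweep xi i x.
Proof.
apply: (@xgetPex _ x [set z | _ --> z]); apply: stationary_cvg => j.
exists (absz (j - i - n%:Z)%R) => m hm; rewrite [LHS]/= /block_at ifF //; apply/negbTE.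
by rewrite negb_and -!ltNge -leNgt; apply/orP; right; lia.
Qed.

End LimitsExist.

(* Main.v *)
Require Import Defs.
From HB Require Import structures.
From mathcomp Require Import all_boot all_order all_algebra.
From mathcomp Require Import boolp.
From mathcomp Require Import zify ring lra.

(* Let k = #|S|, and let N_L be the number of classes of words of length L + 2r,
   two words being equivalent when f produces the same output on them whatever
   2r letters follow.  A block rule of size L + r + 1 swept to the right is a
   transducer with state set S^(L+r), and its states must distinguish the N_L
   classes.  Hence f is a sweeper iff N_L <= k^(L+r) for some L.  For a slider
   the transition of the transducer is a bijection, hence so is the induced
   transition on classes, i.e. N_(L+1) = k N_L, and all classes are represented
   by equally many states, so that N_L divides k^(L+r); conversely a bijection
   S^(L+r) = classes x constant turns these conditions into a slider.
   Moreover N_(L+1) <= k N_L, and by a subset construction and Cayley-Hamilton N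
   satisfies a monic integer recurrence P of degree 2^(k^(2r)).  A sequence that
   satisfies P and vanishes eventually vanishes from deg P on, so for sliders it
   is enough to look at L = deg P + 1.  For sweepers, write P = (X - k)^m q with
   q(k) <> 0; then q applied to N is geometric of ratio k, so that the limit of
   N_L / k^L is the rational number (q N)_0 / q(k).  Such a q showing that the
   limit is at least k^r, together with N_L > k^(L+r) at L = deg P + 1, proves
   that f is not a sweeper, and one searches in parallel for q and for an L with
   N_L <= k^(L+r). *)

Set Implicit Arguments.
Unset Strict Implicit.
Unset Printing Implicit Defensive.

Import Order.TTheory GRing.Theory Num.Theory.

Local Open Scope ring_scope.

(** * Integer linear recurrences *)

Section Recurrences.
Variable R : comNzRingType.
Implicit Types (p q : {poly R}) (a : nat -> R).

(* p evaluated at the shift operator, applied to the sequence a. *)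
Definition act p a L : R := \sum_(j < size p) p`_j * a (L + j)%N.

Lemma act_widen n p a L :
  (size p <= n)%N -> act p a L = \sum_(j < n) p`_j * a (L + j)%N.
Proof.
move=> le; rewrite /act (big_ord_widen _ (fun j => p`_j * a (L + j)%N) le).
rewrite [RHS](bigID (fun j : 'I_n => (j < size p)%N)) /= [X in _ = _ + X]big1 ?addr0 //.
by move=> j; rewrite -leqNgt => /(nth_default 0) ->; rewrite mul0r.
Qed.

Lemma actD p q a L : act (p + q) a L = act p a L + act q a L.
Proof.
have le1 : (size p <= maxn (size p) (size q))%N by apply: leq_maxl.
have le2 : (size q <= maxn (size p) (size q))%N by apply: leq_maxr.
rewrite (act_widen _ _ (size_polyD p q)) (act_widen _ _ le1) (act_widen _ _ le2).
by rewrite -big_split /=; apply: eq_bigr => j _; rewrite coefD mulrDl.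
Qed.

Lemma actC c a L : act c%:P a L = c * a L.
Proof. by rewrite (act_widen _ _ (size_polyC_leq1 c)) big_ord1 coefC addn0. Qed.

Lemma actMX p a L : act (p * 'X) a L = act p a L.+1.
Proof.
have le : (size (p * 'X)%R <= (size p).+1)%N.
  by apply: leq_trans (size_polyMleq _ _) _; rewrite size_polyX addn2.
rewrite (act_widen _ _ le) big_ord_recl coefMX eqxx mul0r add0r.
by apply: eq_bigr => j _; rewrite coefMX /= /bump /= addnS addSn.
Qed.

Lemma actCM c q a L : act (c%:P * q) a L = c * act q a L.
Proof.
have le : (size (c%:P * q)%R <= size q)%N by rewrite mul_polyC size_scale_leq.
rewrite (act_widen _ _ le) /act mulr_sumr; apply: eq_bigr => j _.
by rewrite coefCM mulrA.
Qed.

Lemma actM p q a L : act (p * q) a L = act p (act q a) L.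
Proof.
elim/poly_ind: p L => [|p c IHp] L.
  by rewrite mul0r /act size_poly0 !big_ord0.
by rewrite mulrDl mulrAC !actD !actMX IHp actCM actC.
Qed.

Lemma actXsubC c a L : act ('X - c%:P) a L = a L.+1 - c * a L.
Proof. by rewrite -polyCN actD -['X]mul1r actMX !actC mul1r mulNr. Qed.

Lemma act_act0 p q a : (forall L, act p a L = 0) -> forall L, act (p * q) a L = 0.
Proof.
move=> pa0 L; rewrite mulrC actM /act big1 // => j _.
by rewrite -/(act _ _ _) pa0 mulr0.
Qed.

Lemma act_sub p a b L : act p (fun i => a i - b i) L = act p a L - act p b L.
Proof.
by rewrite /act -sumrN -big_split; apply: eq_bigr => j _; rewrite mulrBr.
Qed.

Lemma act_scale p c a L : act p (fun i => c * a i) L = c * act p a L.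
Proof. by rewrite /act mulr_sumr; apply: eq_bigr => j _; rewrite mulrCA. Qed.

Lemma act_shift p a L : act p (fun i => a i.+1) L = act p a L.+1.
Proof. by apply: eq_bigr => j _; rewrite addSn. Qed.

(** A monic relation of degree [d] determines each term from the [d] preceding ones. *)
Lemma act_eq0_init p a d : p \is monic -> size p = d.+1 ->
  (forall L, act p a L = 0) -> (forall L, (L < d)%N -> a L = 0) ->
  forall L, a L = 0.
Proof.
move=> /monicP p1 sz pa0 a0; elim/ltn_ind => L IH.
case: (ltnP L d) => [/a0//|le]; have := pa0 (L - d)%N.
rewrite (act_widen _ _ (eq_leq sz)) big_ord_recr /= subnK // big1 ?add0r => [|j _].
  by move: p1; rewrite /lead_coef sz => ->; rewrite mul1r.
by rewrite IH ?mulr0 //; move: (ltn_ord j); lia.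
Qed.

End Recurrences.

(** If [i] is the degree of the lowest nonzero coefficient, then [i <= d] and the relation at
    [L - i] determines [a L] from later terms, so zeros propagate downwards to index [i]. *)
Lemma act_eventually0 (R : idomainType) (p : {poly R}) a d L0 :
  p != 0 -> (size p <= d.+1)%N -> (forall L, act p a L = 0) ->
  (forall L, (L0 <= L)%N -> a L = 0) -> forall L, (d <= L)%N -> a L = 0.
Proof.
move=> p0 sz pa0 a0.
have exi : exists i, p`_i != 0 by exists (size p).-1; rewrite -/(lead_coef p) lead_coef_eq0.
case: (ex_minnP exi) => i pi0 mini.
have lti : (i < size p)%N by rewrite ltnNge; apply: contra pi0 => /(nth_default 0)->.
suff H m : forall L, (L0 - m <= L)%N -> (i <= L)%N -> a L = 0.
  by move=> L le; apply: (H L0); lia.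
elim: m => [|m IH] L; first by rewrite subn0 => /a0.
move=> leL leiL; case: (leqP (L0 - m) L) => [/IH->//|ltL].
have := pa0 (L - i)%N; rewrite /act (bigD1 (Ordinal lti)) //= subnK // big1 => [|j ne].
  by rewrite addr0 => /eqP; rewrite mulf_eq0 (negbTE pi0) => /eqP.
have [ltji|leij] := ltnP j i.
  by case: (eqVneq p`_j 0) => [->|/mini]; [rewrite mul0r | rewrite leqNgt ltji].
have : (j != i :> nat) by apply: contraNneq ne => e; apply/eqP/val_inj.
move=> neji; rewrite (IH (L - i + j)%N) ?mulr0 //; move: ltL leL leiL leij neji; lia.
Qed.

(** [p] is the characteristic polynomial of [M]; by Cayley-Hamilton it annihilates every coordinate
    of the orbit [v]. The element [i0] makes [I] nonempty, so that the matrices form a ring. *)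
Lemma linear_recurrence (R : comNzRingType) (I : finType) (i0 : I)
    (M : I -> I -> R) (v : nat -> I -> R) :
  (forall L i, v L.+1 i = \sum_j M i j * v L j) ->
  exists2 p : {poly R}, p \is monic /\ size p = #|I|.+1 &
    forall i L, act p (fun L => v L i) L = 0.
Proof.
have [n cardI] : exists n, #|I| = n.+1.
  by exists #|I|.-1; rewrite prednK //; apply/card_gt0P; exists i0.
move=> vS; pose e (x : 'I_n.+1) : I := enum_val (cast_ord (esym cardI) x).
pose A : 'M[R]_n.+1 := \matrix_(x, y) M (e x) (e y).
pose w L : 'cV[R]_n.+1 := \col_x v L (e x).
have e_bij : bijective e.
  exists (fun i => cast_ord cardI (enum_rank i)) => x.
  - by rewrite /e enum_valK; apply: val_inj.
  - by rewrite /e cast_ordK enum_rankK.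
have wS L : w L.+1 = A *m w L.
  apply/colP => x; rewrite !mxE vS (reindex e) /=; last exact: onW_bij.
  by apply: eq_bigr => y _; rewrite !mxE.
have hw p : forall L, horner_mx A p *m w L = \col_x act p (fun L => v L (e x)) L.
  elim/poly_ind: p => [|p c IH] L.
    rewrite rmorph0 mul0mx; apply/colP => x; rewrite !mxE /act size_poly0 big_ord0 //.
  rewrite rmorphD rmorphM /= horner_mx_X horner_mx_C mulmxDl -mulmxA -wS IH.
  rewrite mul_scalar_mx; apply/colP => x; rewrite !mxE actD actMX actC //.
exists (char_poly A); first by rewrite char_poly_monic size_char_poly cardI.
move=> i L; have [f fK eK] := e_bij.
have := hw (char_poly A) L; rewrite Cayley_Hamilton mul0mx => /colP/(_ (f i)).
by rewrite !mxE eK.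
Qed.

(** If every block of [n] steps after [L1] cost more than [d], about [b L1 / d] blocks would make
    [b] negative. *)
Lemma nonincreasing_small_drop (b : nat -> rat) n L1 d :
  (forall L, b L.+1 <= b L) -> (forall L, 0 <= b L) -> 0 < d ->
  exists2 L, (L1 <= L)%N & b L - b (L + n)%N <= d.
Proof.
move=> bS b0 d0; apply: contrapT => noL.
have drop L : (L1 <= L)%N -> b (L + n)%N < b L - d.
  move=> le; rewrite ltrBrDr -ltrBrDl ltNge; apply/negP => h; apply: noL.
  by exists L.
have H t : b (L1 + t * n)%N <= b L1 - t%:R * d.
  elim: t => [|t IH]; first by rewrite mul0n addn0 mul0r subr0.
  rewrite mulSnr addnA; apply: (le_trans (ltW (drop _ (leq_addr _ _)))).
  by rewrite -natr1; lra.
have := archi_boundP (divr_ge0 (b0 L1) (ltW d0)).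
rewrite ltr_pdivrMr // => ltb; have := H (Num.bound (b L1 / d)).
by have := b0 (L1 + Num.bound (b L1 / d)%R * n)%N; lra.
Qed.

(** This expresses, without naming a limit, that [e] is the sum of the weights times the limit of
    [b]: at an index where [b] hardly drops over [n] steps, each [b (L + j)] may be replaced by
    [b L]. *)
Lemma recurrence_limit (b u : nat -> rat) n e d L1 :
  (forall L, b L.+1 <= b L) -> (forall L, 0 <= b L) ->
  (forall L, \sum_(j < n) u j * b (L + j)%N = e) -> 0 < d ->
  exists2 L, (L1 <= L)%N & `|e - (\sum_(j < n) u j) * b L| <= d.
Proof.
move=> bS b0 eE d0; pose C := 1 + \sum_(j < n) `|u j|.
have C0 : 0 < C by apply: ltr_wpDr => //; apply: sumr_ge0.
have [L le hL] := nonincreasing_small_drop n L1 bS b0 (divr_gt0 d0 C0).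
have mono i j : b (i + j)%N <= b i.
  by elim: j => [|j IH]; rewrite ?addn0 // addnS; apply: le_trans (bS _) IH.
exists L => //; rewrite -(eE L) mulr_suml -sumrB.
apply: le_trans (ler_norm_sum _ _ _) _.
apply: (@le_trans _ _ (\sum_(j < n) `|u j| * (d / C))).
  apply: ler_sum => j _; rewrite -mulrBr normrM ler_wpM2l //.
  rewrite distrC ger0_norm ?subr_ge0 //; apply: le_trans hL.
  rewrite lerD2l lerN2; have := mono (L + j)%N (n - j)%N.
  by rewrite -addnA subnKC // ltnW.
rewrite -mulr_suml mulrA ler_pdivrMr // mulrC ler_pM2l //.
by rewrite /C lerDr.
Qed.

(** * Integer sequences growing by a factor of at most k per step *)

Section Growth.
Variables (k : nat) (N : nat -> int).
Hypotheses (k0 : (0 < k)%N) (N0 : forall L, 0 <= N L).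
Hypothesis NS : forall L, N L.+1 <= k%:Z * N L.

Let b L : rat := (N L)%:~R / k%:R ^+ L.

Let kR : (k%:R : rat) > 0. Proof. by rewrite ltr0n. Qed.

Let b0 L : 0 <= b L.
Proof. by rewrite divr_ge0 ?ler0z ?exprn_ge0 // ltW. Qed.

Let bS L : b L.+1 <= b L.
Proof.
rewrite /b exprS invfM mulrA ler_pM2r ?invr_gt0 ?exprn_gt0 //.
rewrite ler_pdivrMr // mulrC -[k%:R]/((Posz k)%:~R) -intrM ler_int; exact: NS.
Qed.

Let bE L : (N L)%:~R = b L * k%:R ^+ L.
Proof. by rewrite /b divfK // lt0r_neq0 // exprn_gt0. Qed.

Lemma growth_bound L m : N (L + m)%N <= k%:Z ^+ m * N L.
Proof.
elim: m => [|m IH]; first by rewrite addn0 expr0 mul1r.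
rewrite addnS; apply: le_trans (NS _) _.
by rewrite exprS -mulrA ler_wpM2l.
Qed.

Lemma geometric_act (q : {poly int}) L :
  (forall L, act q N L.+1 = k%:Z * act q N L) ->
  act q N L = k%:Z ^+ L * act q N 0.
Proof.
move=> qS; elim: L => [|L IH]; first by rewrite expr0 mul1r.
by rewrite qS IH exprS mulrA.
Qed.

(** Dividing the geometric sequence [act q N] by k^L gives a relation for [b] with constant value
    [act q N 0] and weights q_j k^j, whose sum is q(k). *)
Lemma act_limit (q : {poly int}) d L1 :
  (forall L, act q N L.+1 = k%:Z * act q N L) -> 0 < d ->
  exists2 L, (L1 <= L)%N & `|(act q N 0)%:~R - (q.[k%:Z])%:~R * b L| <= d.
Proof.
move=> qS d0.
have [|L le hL] := @recurrence_limit b (fun j => (q`_j)%:~R * k%:R ^+ j) (size q)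
  (act q N 0)%:~R d L1 bS b0 _ d0.
  move=> L; apply: (@mulfI _ (k%:R ^+ L)); first by rewrite lt0r_neq0 // exprn_gt0.
  rewrite -[k%:R]/((Posz k)%:~R) -rmorphXn -intrM -geometric_act // /act.
  rewrite mulr_sumr rmorph_sum /=; apply: eq_bigr => j _.
  rewrite intrM bE exprD rmorphXn /=; ring.
exists L => //; congr (`|_ - _ * _| <= _): hL.
by rewrite horner_coef rmorph_sum; apply: eq_bigr => j _ /=; rewrite intrM rmorphXn.
Qed.

Definition geom_bounded (e : nat -> int) := exists C, forall L, `|e L| <= C * k%:Z ^+ L.

Lemma geom_bounded_act p e : geom_bounded e -> geom_bounded (act p e).
Proof.
move=> [C eC]; exists (\sum_(j < size p) `|p`_j| * (C * k%:Z ^+ j)) => L.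
apply: le_trans (ler_norm_sum _ _ _) _; rewrite mulr_suml; apply: ler_sum => j _.
by rewrite normrM -!mulrA ler_wpM2l // -exprD addnC.
Qed.

Lemma geom_bounded_simple_root d :
  geom_bounded d -> (forall L, act (('X - k%:Z%:P) ^+ 2) d L = 0) ->
  forall L, act ('X - k%:Z%:P) d L = 0.
Proof.
move=> [C dC] d2 L; set d' := act _ d.
have d'S i : d' i.+1 = k%:Z * d' i.
  by apply/eqP; rewrite -subr_eq0 -actXsubC -actM -expr2 d2.
have d'E i : d' i = k%:Z ^+ i * d' 0%N.
  by elim: i => [|i IH]; rewrite ?mul1r // d'S IH exprS mulrA.
have dS i : d i.+1 = k%:Z * d i + d' i by rewrite /d' actXsubC addrC subrK.
(* The factor [k] on the left avoids the exponent i - 1 in d_i = k^i d_0 + i k^(i-1) d'_0. *)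
have dE i : k%:Z * d i = k%:Z ^+ i * (k%:Z * d 0%N + i%:Z * d' 0%N).
  elim: i => [|i IH]; first by rewrite mul0r addr0 mul1r.
  by rewrite dS mulrDr IH (d'E i) exprS intS; ring.
suff d'0 : d' 0%N = 0 by rewrite d'E d'0 mulr0.
have bnd i : `|k%:Z * d 0%N + i%:Z * d' 0%N| <= k%:Z * C.
  have ki : 0 < k%:Z ^+ i by rewrite exprn_gt0.
  rewrite -(ler_pM2l ki) -{1}(gtr0_norm ki) -normrM -dE normrM ger0_norm //.
  by rewrite mulrCA ler_wpM2l // mulrC.
(* At this index the term linear in [i] exceeds the bound as soon as d'_0 is nonzero. *)
apply: contrapT => /eqP ne; have := bnd (absz (k%:Z * C) + absz (k%:Z * d 0%N)).+1.
by move: ne; move: (k%:Z * C) (k%:Z * d 0%N) (d' 0%N) => A B D ne; nia.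
Qed.

(* A multiple root k would make e grow faster than k^L. *)
Lemma geom_bounded_root m e :
  geom_bounded e -> (forall L, act (('X - k%:Z%:P) ^+ m) e L = 0) ->
  forall L, act ('X - k%:Z%:P) e L = 0.
Proof.
move=> be; elim: m => [|[|m] IH] e0.
- move=> L; have e1 i : e i = 0 by have := e0 i; rewrite expr0 -polyC1 actC mul1r.
  by rewrite actXsubC !e1 mulr0 subr0.
- by move=> L; rewrite -[X in act X]expr1.
- apply: IH => L; rewrite exprS actM.
  apply: geom_bounded_simple_root; first exact: geom_bounded_act.
  by move=> i; rewrite -actM -exprD.
Qed.

(** Splitting all factors X - k off [P] leaves [q] with q(k) <> 0. The sequence [act q N] is bounded
    by a multiple of k^L and annihilated by a power of X - k, hence by X - k itself. The sign of [q]
    is adjusted last. *)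
Lemma geometric_act_exists (P : {poly int}) :
  P != 0 -> (forall L, act P N L = 0) ->
  exists q : {poly int}, [/\ (size q <= size P)%N, 0 < q.[k%:Z] &
    forall L, act q N L.+1 = k%:Z * act q N L].
Proof.
move=> P0 PN; have [m [q]] := multiplicity_XsubC P k%:Z.
rewrite P0 /= => qk PE; have q0 : q != 0 by apply: contraNneq P0 => q0; rewrite PE q0 mul0r.
have bN : geom_bounded N.
  exists (N 0%N) => L; rewrite ger0_norm // mulrC; exact: (growth_bound 0).
have qS L : act q N L.+1 = k%:Z * act q N L.
  apply/eqP; rewrite -subr_eq0 -actXsubC; apply/eqP.
  apply: (@geom_bounded_root m); first exact: geom_bounded_act.
  by move=> i; rewrite -actM mulrC -PE.
have szq : (size q <= size P)%N.
  by rewrite PE size_Mmonic ?monic_exp ?monicXsubC // size_exp_XsubC addnS leq_addr.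
have [q_gt0|q_lt0|] := ltgtP 0 q.[k%:Z]; first by exists q.
- exists (- q); rewrite size_polyN hornerN oppr_gt0; split=> // L.
  by rewrite -mulN1r -polyC1 -polyCN !actCM qS; ring.
- by move=> e; move: qk; rewrite rootE -e eqxx.
Qed.

(** The limit (q N)_0 / q(k) of N_L / k^L is at least [c]. Since both sides of the conclusion are
    integers, an approximation with error 1 is enough. *)
Lemma limit_lower_bound (q : {poly int}) (c : int) :
  (forall L, act q N L.+1 = k%:Z * act q N L) -> 0 < q.[k%:Z] ->
  (forall L, c * k%:Z ^+ L < N L) -> c * q.[k%:Z] <= act q N 0.
Proof.
move=> qS q0 cN; have [L _] := act_limit 0 qS (ltr01 : 0 < (1 : rat)).
have cb : c%:~R < b L.
  by rewrite ltr_pdivlMr ?exprn_gt0 // -[k%:R]/((Posz k)%:~R) -rmorphXn -intrM ltr_int.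
have qr : 0 < (q.[k%:Z])%:~R :> rat by rewrite ltr0z.
rewrite ler_norml => /andP[h _]; move: h; rewrite -(ltr_pM2l qr) in cb => h.
have : (c * q.[k%:Z] - 1)%:~R < (act q N 0)%:~R :> rat.
  by rewrite intrB intrM; lra.
by rewrite ltr_int; lia.
Qed.

(** The quotients N_L / k^L do not increase and their limit is at least [c], so none is below [c].
    If one were equal to [c], all later ones would be; then N_i - c k^i, annihilated by P (X - k),
    would vanish from index [d.+1] on, against the hypothesis at [B]. *)
Lemma above_limit (P q : {poly int}) (c : int) d B :
  P \is monic -> size P = d.+1 -> (d < B)%N -> (forall L, act P N L = 0) ->
  (forall L, act q N L.+1 = k%:Z * act q N L) -> 0 < q.[k%:Z] ->
  c * q.[k%:Z] <= act q N 0 -> c * k%:Z ^+ B < N B ->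
  forall L, c * k%:Z ^+ L < N L.
Proof.
move=> Pm szP dB PN qS q0 cq cB.
have no_lt L1 : c * k%:Z ^+ L1 <= N L1.
  rewrite leNgt; apply/negP => lt1.
  have qr : 0 < (q.[k%:Z])%:~R :> rat by rewrite ltr0z.
  have b1 : b L1 < c%:~R.
    by rewrite ltr_pdivrMr ?exprn_gt0 // -[k%:R]/((Posz k)%:~R) -rmorphXn -intrM ltr_int.
  pose eps : rat := (q.[k%:Z])%:~R * (c%:~R - b L1).
  have eps0 : 0 < eps by rewrite mulr_gt0 // subr_gt0.
  have e2 : 0 < eps / 2 by lra.
  have [L le hL] := act_limit L1 qS e2.
  have bL : b L <= b L1.
    by rewrite -(subnKC le); elim: (L - L1)%N => [|j IH]; rewrite ?addn0 // addnS; apply: le_trans (bS _) IH.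
  move: hL; rewrite ler_norml => /andP[_].
  rewrite -(ler_pM2l qr) in bL.
  have : (c * q.[k%:Z])%:~R <= (act q N 0)%:~R :> rat by rewrite ler_int.
  by rewrite intrM; move: eps0; rewrite /eps; lra.
move=> L; rewrite lt_neqAle no_lt andbT; apply/eqP => cL.
have eqL i : N (L + i)%N = c * k%:Z ^+ (L + i).
  apply/eqP; rewrite eq_le no_lt andbT; apply: le_trans (growth_bound _ _) _.
  by rewrite -cL addnC exprD mulrCA.
pose x i := N i - c * k%:Z ^+ i.
have x0 i : (L <= i)%N -> x i = 0 by move=> le; rewrite /x -(subnKC le) eqL subrr.
have Px i : act (P * ('X - k%:Z%:P)) x i = 0.
  rewrite act_sub act_act0 // sub0r mulrC act_act0 ?oppr0 // => j.
  by rewrite actXsubC exprS; ring.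
have : x B = 0.
  apply: (@act_eventually0 _ (P * ('X - k%:Z%:P)) x d.+1 L _ _ Px x0) => //.
  - by rewrite mulf_neq0 ?monic_neq0 ?monicXsubC.
  - by rewrite size_Mmonic ?monicXsubC ?monic_neq0 // szP size_XsubC addn2.
by rewrite /x => /eqP; rewrite subr_eq0 => /eqP e; move: cB; rewrite e ltxx.
Qed.

End Growth.

(** * Words up to equality of their traces *)

Local Open Scope nat_scope.

(** On [A] the map [g] factors through [f]; if the two images have the same size, the factor [h] is
    injective on the image of [f]. *)
Lemma imset_factor (T U V : finType) (A : {set T}) (f : T -> U) (g : T -> V) :
  {in A &, forall x y, f x = f y -> g x = g y} ->
  #|g @: A| <= #|f @: A| /\
  (#|g @: A| = #|f @: A| -> {in A &, forall x y, g x = g y -> f x = f y}).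
Proof.
move=> fg; have [->|[x0 Ax0]] := set_0Vmem A.
  by rewrite !imset0 !cards0; split=> // _ x y; rewrite inE.
pose h u := g (odflt x0 [pick x in A | f x == u]).
have hf x : x \in A -> h (f x) = g x.
  rewrite /h => Ax; case: pickP => [y /andP[Ay /eqP e]|/(_ x)] /=.
    exact: fg.
  by rewrite Ax eqxx.
have -> : g @: A = h @: (f @: A).
  by rewrite -imset_comp; apply: eq_in_imset => x Ax /=; rewrite hf.
split; first exact: leq_imset_card.
move=> /eqP/imset_injP injh x y Ax Ay.
by rewrite -!hf //; apply: injh; apply: imset_f.
Qed.

Lemma card_imset_ker (T U V : finType) (A : {set T}) (f : T -> U) (g : T -> V) :
  {in A &, forall x y, f x = f y <-> g x = g y} -> #|f @: A| = #|g @: A|.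
Proof.
move=> fg; apply/eqP; rewrite eqn_leq.
by apply/andP; split; apply: (imset_factor _).1 => x y Ax Ay /fg->.
Qed.

Lemma card_fibers (T U : finType) (Y : {set T * U}) :
  #|Y| = \sum_s #|[set t | (s, t) \in Y]|.
Proof.
rewrite -sum1_card (eq_bigr (fun s => \sum_(t | (s, t) \in Y) 1)); last first.
  by move=> s _; rewrite -sum1_card; apply: eq_bigl => t; rewrite inE.
by rewrite pair_big_dep /=; apply: eq_bigl => -[].
Qed.

Section Words.
Variables (S : finType) (s0 : S) (r : nat) (floc : (2 * r).+1.-tuple S -> S).
Implicit Types (u w c : seq S) (a b s : S) (X : {set (2 * r).-tuple S}).

(** The window starts at [j], so this is the value of the automaton at position [j + r] of the
    word. *)
Definition out u j : S := floc [tuple nth s0 u (j + i) | i < (2 * r).+1].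

Lemma eq_out u u' j j' :
  (forall i, i <= 2 * r -> nth s0 u (j + i) = nth s0 u' (j' + i)) ->
  out u j = out u' j'.
Proof. by move=> uu'; congr floc; apply: eq_mktuple => i; apply: uu'; rewrite -ltnS. Qed.

Lemma out_cons a u j : out (a :: u) j.+1 = out u j.
Proof. exact: eq_out. Qed.

(** Recording the outputs for all continuations of length 2r as one finite function turns the
    classes of words of length L + 2r into elements of a finite type. *)
Definition trace L w : {ffun (2 * r).-tuple S * 'I_(L + 2 * r) -> S} :=
  [ffun p : (2 * r).-tuple S * 'I_(L + 2 * r) => out (w ++ p.1) p.2].

Lemma trace_eqP L w w' : size w = L + 2 * r -> size w' = L + 2 * r ->
  trace L w = trace L w' <->
  forall c j, j + 2 * r < size w + size c -> out (w ++ c) j = out (w' ++ c) j.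
Proof.
move=> szw szw'; split=> [/ffunP eqw c j ltj|eqw]; last first.
  apply/ffunP => -[c j]; rewrite !ffunE eqw //= szw size_tuple.
  by move: (ltn_ord j); lia.
have [ltj'|gej] := ltnP j (L + 2 * r); last first.
  apply: eq_out => i lei; rewrite !nth_cat szw szw' !ltnNge.
  by rewrite (leq_trans gej (leq_addr _ _)).
have := eqw (mktuple (fun k : 'I_(2 * r) => nth s0 c k), Ordinal ltj').
have E v : size v = L + 2 * r ->
    out (v ++ mktuple (fun k : 'I_(2 * r) => nth s0 c k)) j = out (v ++ c) j.
  move=> szv; apply: eq_out => i lei; rewrite !nth_cat; case: ifP => // /negbT.
  rewrite -leqNgt szv => lev.
  have lt : j + i - (L + 2 * r) < 2 * r by lia.
  by rewrite -[_ - _]/(val (Ordinal lt)) -tnth_nth tnth_mktuple.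
by rewrite !ffunE /= !E.
Qed.

Lemma trace_behead L u u' : size u = L.+1 + 2 * r -> size u' = L.+1 + 2 * r ->
  trace L.+1 u = trace L.+1 u' <->
  out u 0 = out u' 0 /\ trace L (behead u) = trace L (behead u').
Proof.
move=> szu szu'; rewrite !trace_eqP ?size_behead ?szu ?szu' //.
case: u u' szu szu' => [|a u] [|a' u'] //= szu szu'; split=> [H|[H0 H] c [|j] ltj].
- split=> [|c j ltj].
    have := H [::] 0; rewrite !cats0; apply; lia.
  have := H c j.+1; rewrite /= !out_cons; apply; lia.
- have E b v : size v = L + 2 * r -> out (b :: v ++ c) 0 = out (b :: v) 0.
    move=> szv; apply: eq_out => i lei; rewrite -cat_cons nth_cat /= ifT //; lia.
  rewrite !E //; lia.
- rewrite !out_cons; apply: H; lia.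
Qed.

Lemma trace_rcons L w w' s : size w = L + 2 * r -> size w' = L + 2 * r ->
  trace L w = trace L w' -> trace L.+1 (rcons w s) = trace L.+1 (rcons w' s).
Proof.
move=> szw szw'; rewrite !trace_eqP ?size_rcons ?szw ?szw' // => H c j ltj.
rewrite !cat_rcons; apply: H => /=; lia.
Qed.

Definition pre u : (2 * r).-tuple S := mktuple (fun i : 'I_(2 * r) => nth s0 u i).

Lemma nth_pre u i : i < 2 * r -> nth s0 (pre u) i = nth s0 u i.
Proof. by move=> lt; rewrite -[i]/(val (Ordinal lt)) -tnth_nth tnth_mktuple. Qed.

Lemma eq_pre u u' : (forall i, i < 2 * r -> nth s0 u i = nth s0 u' i) -> pre u = pre u'.
Proof. by move=> uu'; apply: eq_mktuple => i; apply: uu'. Qed.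

Definition traces L X := [set trace L w | w : (L + 2 * r).-tuple S & pre w \in X].

Lemma tracesP L X t :
  reflect (exists w, [/\ size w = L + 2 * r, pre w \in X & t = trace L w])
          (t \in traces L X).
Proof.
apply: (iffP imsetP) => [[w]|[w [szw wX ->]]].
  by rewrite inE => wX ->; exists w; rewrite size_tuple.
by exists (tcast szw (in_tuple w)); rewrite ?inE /= ?val_tcast.
Qed.

Definition ntraces L := #|traces L setT|.

(* The subset automaton: ends of the words starting in X whose output starts with s. *)
Definition step X s : {set (2 * r).-tuple S} :=
  [set a | [exists b in X, [exists t,
     (pre (behead (rcons b t)) == a) && (out (rcons b t) 0 == s)]]].

Definition split_traces L X :=
  [set (out w 0, trace L (behead w)) | w : (L.+1 + 2 * r).-tuple S & pre w \in X].

Lemma split_tracesP L X p :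
  reflect (exists w, [/\ size w = L.+1 + 2 * r, pre w \in X &
                         p = (out w 0, trace L (behead w))])
          (p \in split_traces L X).
Proof.
apply: (iffP imsetP) => [[w]|[w [szw wX ->]]].
  by rewrite inE => wX ->; exists w; rewrite size_tuple.
by exists (tcast szw (in_tuple w)); rewrite ?inE /= ?val_tcast.
Qed.

Lemma card_split_traces L X : #|split_traces L X| = #|traces L.+1 X|.
Proof.
apply: card_imset_ker => u u' _ _.
rewrite (trace_behead (size_tuple u) (size_tuple u')).
by split=> [[-> ->]|[-> ->]].
Qed.

(** Traces with different first outputs are different, and the tails of the words whose first output
    is [s] are exactly the words beginning in [step X s]. *)
Lemma traces_rec L X : #|traces L.+1 X| = \sum_s #|traces L (step X s)|.
Proof.
rewrite -card_split_traces card_fibers; apply: eq_bigr => s _; congr #|pred_of_set _|.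
apply/setP => t; rewrite inE; apply/split_tracesP/tracesP.
- move=> [w [szw wX [-> ->]]]; exists (behead w).
  rewrite size_behead szw; split=> //.
  have nthE i : i <= 2 * r -> nth s0 (rcons (pre w) (nth s0 w (2 * r))) i = nth s0 w i.
    rewrite nth_rcons size_tuple leq_eqVlt => /orP[/eqP->|lt].
      by rewrite ltnn eqxx.
    by rewrite lt nth_pre.
  rewrite inE; apply/existsP; exists (pre w); rewrite wX /=.
  apply/existsP; exists (nth s0 w (2 * r)); apply/andP; split; apply/eqP.
    by apply: eq_pre => i lti; rewrite !nth_behead nthE.
  by apply: eq_out => i lei; rewrite nthE.
- move=> [w [szw]]; rewrite inE => /existsP[b /andP[bX /existsP[a /andP[/eqP prew /eqP outs]]]] ->.
  (* The restored letter is the first one of [rcons b a] rather than of [b], which is empty when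
     [r = 0]. *)
  have nthE i : i <= 2 * r ->
      nth s0 (nth s0 (rcons b a) 0 :: w) i = nth s0 (rcons b a) i.
    case: i => [|i] //= lti.
    by rewrite -(nth_pre w lti) -prew nth_pre // nth_behead.
  exists (nth s0 (rcons b a) 0 :: w); split; first by rewrite /= szw.
    rewrite (_ : pre _ = b) //; apply: eq_from_tnth => i.
    rewrite !(tnth_nth s0) nth_pre // nthE ?(ltnW (ltn_ord i)) //.
    by rewrite nth_rcons size_tuple ltn_ord.
  by congr pair; rewrite -outs; apply: eq_out => i lei; rewrite nthE.
Qed.

Lemma ntraces_S_le L : ntraces L.+1 <= #|S| * ntraces L.
Proof.
rewrite /ntraces traces_rec -sum_nat_const; apply: leq_sum => s _.
by apply: subset_leq_card; apply: imsetS; apply/subsetP => w; rewrite !inE.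
Qed.

(** Sending a word to its first output and the class of its tail is onto all pairs; [stableP] shows
    that this is the case of equality in [ntraces_S_le]. *)
Definition stable L := forall a w, size w = L + 2 * r ->
  exists u, [/\ size u = L.+1 + 2 * r, out u 0 = a & trace L (behead u) = trace L w].

Lemma stableP L : stable L <-> ntraces L.+1 = #|S| * ntraces L.
Proof.
have sub : split_traces L setT \subset finset.setX setT (traces L setT).
  apply/subsetP => p /split_tracesP[w [szw _ ->]]; rewrite !inE /=.
  by apply/tracesP; exists (behead w); rewrite size_behead szw inE.
rewrite /ntraces -card_split_traces -cardsT -cardsX; split=> [st|eqc].
  apply/eqP; rewrite eqn_leq (subset_leq_card sub); apply: subset_leq_card.
  apply/subsetP => -[a t]; rewrite !inE /= => /tracesP[w [szw _ ->]].
  have [u [szu <- <-]] := st a w szw.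
  by apply/split_tracesP; exists u; rewrite inE.
have /eqP E : split_traces L setT == finset.setX setT (traces L setT).
  by rewrite eqEcard sub eqc leqnn.
move=> a w szw; have : (a, trace L w) \in split_traces L setT.
  by rewrite E !inE; apply/tracesP; exists w; rewrite inE.
by case/split_tracesP => u [szu _ [-> ->]]; exists u.
Qed.

(** The last letter of the word is set aside and appended to the word found for the rest. *)
Lemma stable_S L : stable L -> stable L.+1.
Proof.
move=> st a w; case/lastP: w => [|w t] //; rewrite size_rcons => -[szw].
have [u [szu outu eqt]] := st a w szw; exists (rcons u t).
rewrite size_rcons szu; split=> //.
  rewrite -outu; apply: eq_out => i lei; rewrite nth_rcons szu ifT //; lia.
case: u szu eqt {outu} => //= b u [szu] eqt; exact: trace_rcons.
Qed.

(** The class of [w] and the letter [s] determine the class of [rcons w s]. Under stability there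
    are as many such classes as pairs, so the converse holds as well. *)
Lemma stable_rcons_inj L w w' s s' : stable L ->
  size w = L + 2 * r -> size w' = L + 2 * r ->
  trace L.+1 (rcons w s) = trace L.+1 (rcons w' s') -> trace L w = trace L w' /\ s = s'.
Proof.
move=> /stableP cardE szw szw'.
pose f (p : (L + 2 * r).-tuple S * S) := (trace L p.1, p.2).
pose g (p : (L + 2 * r).-tuple S * S) := trace L.+1 (rcons p.1 p.2).
have [|_ inj] := @imset_factor _ _ _ setT f g.
  by move=> [v a] [v' a'] _ _ [eqv ->]; apply: trace_rcons; rewrite ?size_tuple.
have imf : f @: setT = finset.setX (traces L setT) setT.
  apply/setP => -[t a]; rewrite !inE andbT /=; apply/imsetP/tracesP => [[[v b] _ [-> _]]|[v [szv _ ->]]].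
    by exists v; rewrite size_tuple inE.
  by exists (tcast szv (in_tuple v), a); rewrite ?inE // /f /= val_tcast.
have img : g @: setT = traces L.+1 setT.
  apply/setP => t; apply/imsetP/tracesP => [[[v b] _ ->]|[v [szv _ ->]]].
    by exists (rcons v b); rewrite size_rcons size_tuple inE.
  case/lastP: v szv => // v b; rewrite size_rcons => -[szv].
  by exists (tcast szv (in_tuple v), b); rewrite ?inE // /g /= val_tcast.
have eqc : #|g @: setT| = #|f @: setT|.
  by rewrite imf img cardsX cardsT -/(ntraces _) cardE mulnC.
move=> eqt; have := inj eqc (tcast szw (in_tuple w), s) (tcast szw' (in_tuple w'), s')
  (in_setT _) (in_setT _).
by rewrite /f /g /= !val_tcast => /(_ eqt)[-> ->].
Qed.

(** The counts for all sets [X] of initial words evolve linearly, with matrix entry [M X Y] the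
    number of letters leading from [X] to [Y]. The degree is the number of sets [X]. *)
Lemma ntraces_recurrence : exists P : {poly int},
  [/\ P \is monic, size P = (2 ^ (#|S| ^ (2 * r))).+1 &
      forall L, act P (fun L => Posz (ntraces L)) L = 0%R].
Proof.
pose M (X Y : {set (2 * r).-tuple S}) : int := Posz (\sum_(s | step X s == Y) 1).
have [|P [Pm szP] PE] := @linear_recurrence _ _ setT M (fun L X => Posz #|traces L X|).
  move=> L X; rewrite traces_rec (partition_big (step X) xpredT) //=.
  rewrite -[LHS]/(Posz _) (big_morph Posz PoszD (erefl _)); apply: eq_bigr => Y _.
  rewrite /M -PoszM big_distrl /=; congr Posz.
  by apply: eq_bigr => s /eqP->; rewrite mul1n.
exists P; split=> //.
  by rewrite szP -cardsT -powersetT card_powerset cardsT card_tuple.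
exact: PE.
Qed.

End Words.

(** * One-sided sweeps *)

Local Open Scope ring_scope.

Lemma int_split (P : int -> Prop) (i : int) :
  (forall j, j < i -> P j) -> (forall d : nat, P (i + d%:Z)) -> forall j, P j.
Proof.
move=> lt ge j; have [/lt//|le] := ltP j i.
by rewrite -(subrK i j) addrC -(gez0_abs (_ : 0 <= j - i)) ?subr_ge0.
Qed.

Section Windows.
Variables (S : finType) (s0 : S).
Implicit Types (x y z : config S) (i j : int).

Lemma nth_window n x i k : (k < n)%N -> nth s0 (window n x i) k = x (i + k%:Z) :> S.
Proof. by move=> lt; rewrite -[k]/(val (Ordinal lt)) -tnth_nth tnth_mktuple. Qed.

Lemma eq_window n x x' i i' :
  (forall k, (k < n)%N -> x (i + k%:Z) = x' (i' + k%:Z)) ->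
  window n x i = window n x' i'.
Proof. by move=> xx'; apply: eq_mktuple => k; apply: xx'. Qed.

Lemma window_eqP n x i (v : n.-tuple S) :
  (forall k, (k < n)%N -> x (i + k%:Z) = nth s0 v k :> S) -> window n x i = v.
Proof. by move=> xv; apply: eq_from_tnth => k; rewrite tnth_mktuple (tnth_nth s0) xv. Qed.

Lemma window_rcons n x i :
  window n.+1 x i = rcons (window n x i) (x (i + n%:Z)) :> seq S.
Proof.
apply: (@eq_from_nth _ s0) => [|k]; rewrite ?size_rcons !size_tuple // => ltk.
rewrite nth_window // nth_rcons size_tuple; case: ltnP => [lt|le].
  by rewrite nth_window.
by rewrite (_ : k = n) ?eqxx //; lia.
Qed.

Lemma behead_window n x i : behead (window n.+1 x i) = window n x (i + 1) :> seq S.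
Proof.
apply: (@eq_from_nth _ s0) => [|k]; rewrite size_behead !size_tuple // => ltk.
by rewrite nth_behead !nth_window //; congr (x _); lia.
Qed.

Lemma tuple_rcons n (v : n.+1.-tuple S) :
  exists (q : n.-tuple S) (s : S), v = rcons q s :> seq S.
Proof.
case: v => -[|a u] //= szu; rewrite lastI; have szb := size_belast a u.
have {}szb : size (belast a u) == n by rewrite szb; move: szu.
by exists (Tuple szb), (last a u).
Qed.

Lemma tuple_prefix n (v : n.+1.-tuple S) (q : n.-tuple S) s :
  v = rcons q s :> seq S -> mktuple (fun k : 'I_n => nth s0 v k) = q.
Proof.
move=> vE; apply: eq_from_tnth => k.
by rewrite tnth_mktuple vE nth_rcons size_tuple ltn_ord -tnth_nth.
Qed.

Variables (r : nat) (floc : (2 * r).+1.-tuple S -> S).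

Lemma out_window m x i (j : nat) : (j + 2 * r < m)%N ->
  out s0 floc (window m x i) j = ca_map floc x (i + j%:Z + r%:Z) :> S.
Proof.
move=> lt; congr floc; apply: eq_from_tnth => k; rewrite !tnth_mktuple.
rewrite nth_window; last by move: (ltn_ord k); lia.
by congr (x _); lia.
Qed.

Lemma out_cat_window m m' x i (c : seq S) (j : nat) : (j + 2 * r < m + m')%N ->
  (forall k, (k < m')%N -> nth s0 c k = x (i + (m + k)%:Z) :> S) ->
  out s0 floc (window m x i ++ c) j = ca_map floc x (i + j%:Z + r%:Z) :> S.
Proof.
move=> lt xc; rewrite -(out_window _ _ lt); apply: eq_out => k lek.
have ltjk : (j + k < m + m')%N by lia.
rewrite nth_cat size_tuple [RHS]nth_window //.
case: ltnP => [ltm|lem]; first by rewrite nth_window.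
by rewrite xc ?subnKC //; lia.
Qed.

Lemma eq_ca_map x x' j j' :
  (forall k, (k <= 2 * r)%N -> x (j - r%:Z + k%:Z) = x' (j' - r%:Z + k%:Z)) ->
  ca_map floc x j = ca_map floc x' j'.
Proof. by move=> xx'; congr floc; apply: eq_window => k; apply: xx'. Qed.

End Windows.

Section Sweeps.
Variables (S : finType) (p : nat).
Implicit Types (x y z : config S) (i j : int) (chi xi : p.+1.-tuple S -> p.+1.-tuple S).

Lemma block_at_out chi i x j :
  j < i \/ i + p%:Z < j -> block_at chi i x j = x j.
Proof. by move=> h; rewrite /block_at ifF //; lia. Qed.

Lemma block_at_in s0 chi i x k : (k <= p)%N ->
  block_at chi i x (i + k%:Z) = nth s0 (chi (window p.+1 x i)) k :> S.
Proof.
move=> le; rewrite /block_at ifT; last by lia.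
have -> : absz (i + k%:Z - i)%R = k by lia.
by apply: set_nth_default; rewrite size_tuple.
Qed.

Lemma window_block chi i x : window p.+1 (block_at chi i x) i = chi (window p.+1 x i).
Proof.
apply: (@window_eqP _ (x i)) => k ltk; exact: block_at_in.
Qed.

Lemma block_atK chi xi i x :
  cancel chi xi -> block_at xi i (block_at chi i x) = x.
Proof.
move=> chiK; apply/funext => j.
have [h|h] : (j < i \/ i + p%:Z < j) \/ (i <= j /\ j <= i + p%:Z) by lia.
  by rewrite !block_at_out.
have -> : j = i + (absz (j - i)%R)%:Z by lia.
have le : (absz (j - i)%R <= p)%N by lia.
by rewrite (block_at_in (x i)) // window_block chiK nth_window.
Qed.

Lemma eq_block_at_ge chi x x' i i' :
  (forall d : nat, x (i + d%:Z) = x' (i' + d%:Z)) ->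
  forall e d : nat, block_at chi (i + e%:Z) x (i + d%:Z) =
                    block_at chi (i' + e%:Z) x' (i' + d%:Z).
Proof.
move=> xx' e d.
have [h|h] : (d < e \/ e + p < d)%N \/ (e <= d /\ d <= e + p)%N by lia.
  by rewrite !block_at_out //; lia.
have E k : k + d%:Z = k + e%:Z + (d - e)%N%:Z by lia.
rewrite !E !(block_at_in (x i)); try lia.
congr nth; congr (tval (chi _)); apply: eq_window => k ltk.
by have := xx' (e + k)%N; rewrite PoszD !addrA.
Qed.

Lemma eq_block_at_lt chi x x' i b : i + p%:Z < b ->
  (forall j, j < b -> x j = x' j) ->
  forall j, j < b -> block_at chi i x j = block_at chi i x' j.
Proof.
move=> ib xx' j jb.
have [h|h] : (j < i \/ i + p%:Z < j) \/ (i <= j /\ j <= i + p%:Z) by lia.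
  by rewrite !block_at_out // xx'.
have -> : j = i + (absz (j - i)%R)%:Z by lia.
rewrite !(block_at_in (x i)); try lia.
by congr nth; congr (tval (chi _)); apply: eq_window => k ltk; apply: xx'; lia.
Qed.

Lemma rsteps_ge chi i m x j : i + m%:Z + p%:Z <= j -> rsteps chi i m x j = x j.
Proof.
by elim: m => //= m IH h; rewrite block_at_out ?IH //; lia.
Qed.

Lemma rsteps_stable chi i m m' x j :
  j < i + m%:Z -> rsteps chi i (m + m') x j = rsteps chi i m x j.
Proof.
move=> lt; elim: m' => [|m' IH]; rewrite ?addn0 // addnS /= block_at_out //; lia.
Qed.

Lemma rsweepE chi i m x j : j < i + m%:Z -> rsweep chi i x j = rsteps chi i m x j.
Proof.
move=> lt; have /cvg_configP/(_ j)[M hM] := @rsweep_cvg S p.+1 chi i x.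
by rewrite -(hM (m + M)%N) ?leq_addl // rsteps_stable.
Qed.

Lemma rsweep_lt chi i x j : j < i -> rsweep chi i x j = x j.
Proof. by move=> lt; rewrite (@rsweepE _ _ 0) // addr0. Qed.

Lemma rstepsS chi i m x : rsteps chi i m.+1 x = rsteps chi (i + 1) m (block_at chi i x).
Proof.
elim: m => [|m IH]; first by rewrite /= addr0.
by rewrite -[LHS]/(block_at chi (i + m.+1%:Z) (rsteps chi i m.+1 x)) IH /= -addrA -intS.
Qed.

Lemma rsweep_step chi i x : rsweep chi i x = rsweep chi (i + 1) (block_at chi i x).
Proof.
apply/funext => j; rewrite (@rsweepE _ _ (absz (j - i)%R).+1); last by lia.
by rewrite rstepsS -rsweepE //; lia.
Qed.

Lemma rsweep_rsteps chi i m x : rsweep chi (i + m%:Z) (rsteps chi i m x) = rsweep chi i x.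
Proof.
elim: m => [|m IH]; rewrite ?addr0 //= -IH [in RHS]rsweep_step.
by congr (rsweep chi _ _); lia.
Qed.

Lemma eq_rsteps_lt chi x x' i m :
  (forall j, j < i + m%:Z + p%:Z -> x j = x' j) ->
  forall j, j < i + m%:Z + p%:Z -> rsteps chi i m x j = rsteps chi i m x' j.
Proof.
suff H b m' : i + m'%:Z + p%:Z <= b -> (forall j, j < b -> x j = x' j) ->
    forall j, j < b -> rsteps chi i m' x j = rsteps chi i m' x' j by apply: H.
elim: m' => //= m' IH le xx' j jb; apply: (@eq_block_at_lt _ _ _ _ b) => //; first by lia.
by apply: IH => //; lia.
Qed.

(** A sweep from [i] never reads coordinates left of [i] and applies the same rule everywhere, so
    only contents relative to the starting point matter. *)
Lemma eq_rsweep chi x x' i i' :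
  (forall d : nat, x (i + d%:Z) = x' (i' + d%:Z)) ->
  forall d : nat, rsweep chi i x (i + d%:Z) = rsweep chi i' x' (i' + d%:Z).
Proof.
move=> xx' d; rewrite !(@rsweepE _ _ d.+1); try lia.
move: d.+1 => m; elim: m d => [|m IH] d //=; exact: eq_block_at_ge.
Qed.

Lemma lsteps_stable xi i m m' x j :
  i - m%:Z + p%:Z <= j -> lsteps xi i (m + m') x j = lsteps xi i m x j.
Proof.
move=> le; elim: m' => [|m' IH]; rewrite ?addn0 // addnS /= block_at_out //; lia.
Qed.

Lemma lsweepE xi i m x j :
  i - m%:Z + p%:Z <= j -> lsweep xi i x j = lsteps xi i m x j.
Proof.
move=> le; have /cvg_configP/(_ j)[M hM] := @lsweep_cvg S p.+1 xi i x.
by rewrite -(hM (m + M)%N) ?leq_addl // lsteps_stable.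
Qed.

Lemma lsweep_ge xi i x j : i + p%:Z <= j -> lsweep xi i x j = x j.
Proof. by move=> le; rewrite (@lsweepE _ _ 0) // subr0. Qed.

Lemma lstepsS xi i m x :
  lsteps xi i m.+1 x = lsteps xi (i - 1) m (block_at xi (i - 1) x).
Proof.
elim: m => [|m IH] //.
rewrite -[LHS]/(block_at xi (i - m.+2%:Z) (lsteps xi i m.+1 x)) IH /=.
by congr (block_at xi _ _); lia.
Qed.

Lemma lsweep_step xi i x : lsweep xi i x = lsweep xi (i - 1) (block_at xi (i - 1) x).
Proof.
apply/funext => j; rewrite (@lsweepE _ _ (absz (i + p%:Z - j)%R).+1); last by lia.
by rewrite lstepsS -lsweepE //; lia.
Qed.

Lemma eq_lsweep xi x x' i : (forall j, j < i + p%:Z -> x j = x' j) ->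
  forall j, j < i + p%:Z -> lsweep xi i x j = lsweep xi i x' j.
Proof.
move=> xx' j lt; rewrite !(@lsweepE _ _ (absz (i + p%:Z - j)%R)); try lia.
move: (absz (i + p%:Z - j)%R) => m; elim: m j lt => [|m IH] j lt /=; first exact: xx'.
by apply: (@eq_block_at_lt _ _ _ _ (i + p%:Z)) => //; lia.
Qed.

Section Inverse.
Variables chi xi : p.+1.-tuple S -> p.+1.-tuple S.
Hypotheses (chiK : cancel chi xi) (xiK : cancel xi chi).

Lemma lsweep_succ i x : lsweep xi (i + 1) (block_at chi i x) = lsweep xi i x.
Proof. by rewrite lsweep_step addrK block_atK. Qed.

Lemma rsweep_lsteps i m x : rsweep chi (i - m%:Z) (lsteps xi i m x) = rsweep chi i x.
Proof.
elim: m => [|m IH]; rewrite ?subr0 //= rsweep_step block_atK // -IH.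
by congr (rsweep chi _ _); lia.
Qed.

(** Moving the starting point by one coordinate is compensated by one application of [chi] or [xi]
    to [x]. *)
Lemma lsweep_recenter i x : exists x', lsweep xi 0 x' = lsweep xi i x.
Proof.
suff H m : forall i x, (i = m%:Z \/ i = - m%:Z) -> exists x', lsweep xi 0 x' = lsweep xi i x.
  by apply: (H (absz i)); lia.
elim: m => [|m IH] {}i {}x im; first by exists x; congr (lsweep xi _ _); lia.
case: im => im.
- have [|x' E] := IH (i - 1) (block_at xi (i - 1) x); first by lia.
  by exists x'; rewrite E -lsweep_step.
- have [|x' E] := IH (i + 1) (block_at chi i x); first by lia.
  by exists x'; rewrite E lsweep_succ.
Qed.

End Inverse.
End Sweeps.

(** * Sweepers and sliders from few traces *)

Section Realization.
Variables (S : finType) (s0 : S) (r : nat) (floc : (2 * r).+1.-tuple S -> S) (L : nat).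
Implicit Types (x y z : config S) (i j : int).

Local Notation p := (L + r)%N.
Local Notation f := (ca_map floc).
Local Notation out := (out s0 floc).
Local Notation trace := (trace s0 floc L).
Local Notation ntraces := (ntraces s0 floc).

(* A word of length p is read as a class of words of length L + 2r under
   equality of traces, together with an inert index kap < m. *)
Lemma trace_coding m : (0 < m)%N -> (ntraces L * m <= #|S| ^ p)%N ->
  exists (dec : p.-tuple S -> seq S) (kap : p.-tuple S -> nat)
         (enc : {ffun (2 * r).-tuple S * 'I_(L + 2 * r) -> S} -> nat -> p.-tuple S),
  [/\ forall q, size (dec q) = (L + 2 * r)%N, forall q, (kap q < m)%N,
      forall w k, size w = (L + 2 * r)%N -> (k < m)%N ->
        trace (dec (enc (trace w) k)) = trace w /\ kap (enc (trace w) k) = k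
    & (ntraces L * m = #|S| ^ p)%N -> forall q q',
        trace (dec q) = trace (dec q') -> kap q = kap q' -> q = q'].
Proof.
move=> m0 le; pose T := traces s0 floc L setT; pose w0 := nseq (L + 2 * r) s0.
pose rep t : seq S := odflt [tuple of w0] [pick w : (L + 2 * r).-tuple S | trace w == t].
have szrep t : size (rep t) = (L + 2 * r)%N by rewrite size_tuple.
have repT t : t \in T -> trace (rep t) = t.
  move=> /imsetP[w _ ->]; rewrite /rep; case: pickP => [w' /eqP //|/(_ w)].
  by rewrite eqxx.
have traceT w : size w = (L + 2 * r)%N -> trace w \in T.
  by move=> szw; apply/tracesP; exists w; rewrite inE.
have cardD : #|{: p.-tuple S}| = (#|S| ^ p)%N by rewrite card_tuple.
pose t0 := trace w0; pose q0 : p.-tuple S := [tuple of nseq p s0].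
have t0T : t0 \in T by apply: traceT; rewrite size_nseq.
(* The number of [q], divided by [m], gives the index of the class as quotient and the inert index
   as remainder. Quotients beyond the number of classes stand for the default class [t0]. *)
pose tr (q : p.-tuple S) := nth t0 (enum T) (enum_rank q %/ m).
have trT q : tr q \in T.
  rewrite /tr; have [lt|ge] := ltnP (enum_rank q %/ m) (size (enum T)).
    by rewrite -mem_enum mem_nth.
  by rewrite nth_default.
pose enc t k := nth q0 (enum {: p.-tuple S}) (index t (enum T) * m + k).
have encE t k : t \in T -> (k < m)%N -> enum_rank (enc t k) = (index t (enum T) * m + k)%N :> nat.
  move=> tT km; have lt : (index t (enum T) * m + k < #|{: p.-tuple S}|)%N.
    rewrite cardD; apply: leq_trans le; have : (index t (enum T) < ntraces L)%N.
      by rewrite /ntraces -/T cardE index_mem mem_enum.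
    by move: (index _ _) (ntraces L) km => a b; nia.
  have -> : enc t k = enum_val (Ordinal lt) by rewrite (enum_val_nth q0).
  by rewrite enum_valK.
exists (fun q => rep (tr q)), (fun q => enum_rank q %% m)%N, enc; split=> //.
- by move=> q; rewrite ltn_mod.
- move=> w k szw km; have tT := traceT _ szw; rewrite repT // /tr !encE //.
  rewrite divnMDl // divn_small // addn0 nth_index ?mem_enum //.
  by rewrite modnMDl modn_small.
- move=> eqm q q'; rewrite !repT // => eqt eqk; apply: enum_rank_inj; apply: val_inj.
  have ltT (q1 : p.-tuple S) : (enum_rank q1 %/ m < size (enum T))%N.
    rewrite -cardE -[#|T|]/(ntraces L) ltn_divLR // eqm -cardD; exact: ltn_ord.
  rewrite /= (divn_eq (enum_rank q) m) eqk (divn_eq (enum_rank q') m); congr (_ * _ + _)%N.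
    by apply/eqP; rewrite -(nth_uniq t0 (ltT _) (ltT _) (enum_uniq _)); apply/eqP.
  by rewrite -divn_eq.
Qed.

(** A block rule is seen as a transducer: from state [q] and input letter [s] it emits the first
    letter of its value and keeps the rest as next state. A state [q] stands for the class of
    [dec q]. *)
Definition realizes (dec : p.-tuple S -> seq S) (chi : p.+1.-tuple S -> p.+1.-tuple S) :=
  forall (v : p.+1.-tuple S) (q : p.-tuple S) s, v = rcons q s :> seq S ->
    head s0 (chi v) = out (rcons (dec q) s) 0 /\
    exists q' : p.-tuple S, behead (chi v) = q' :> seq S /\
      trace (dec q') = trace (behead (rcons (dec q) s)).

Section Run.
Variables (dec : p.-tuple S -> seq S) (chi : p.+1.-tuple S -> p.+1.-tuple S).
Hypothesis szdec : forall q, size (dec q) = (L + 2 * r)%N.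
Hypothesis chiP : realizes dec chi.

(** The hypotheses are the invariant of a run on input [y] at position [i]: the window at [i] stands
    for the class of [y] on [i - r, i + p), and the input from i + p on is still unread. *)
Lemma run_step x y i :
  trace (dec (window p x i)) = trace (window (L + 2 * r) y (i - r%:Z)) ->
  (forall d, (p <= d)%N -> x (i + d%:Z) = y (i + d%:Z)) ->
  [/\ block_at chi i x i = f y i,
      trace (dec (window p (block_at chi i x) (i + 1))) =
        trace (window (L + 2 * r) y (i + 1 - r%:Z))
    & forall d, (p <= d)%N -> block_at chi i x (i + 1 + d%:Z) = y (i + 1 + d%:Z)].
Proof.
move=> eqt xy; have [hd [q' [tl eqq']]] := chiP (window_rcons s0 p x i).
have szw : size (window (L + 2 * r) y (i - r%:Z)) = (L + 2 * r)%N by rewrite size_tuple.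
have W : rcons (window (L + 2 * r) y (i - r%:Z)) (x (i + p%:Z)) =
         window (L.+1 + 2 * r) y (i - r%:Z).
  rewrite addSn window_rcons // xy //; congr (rcons _ (y _)); lia.
have := trace_rcons (x (i + p%:Z)) (szdec _) szw eqt.
rewrite W trace_behead ?size_rcons ?szdec ?size_tuple // => -[eqo eqb].
have wq' : window p (block_at chi i x) (i + 1) = q'.
  by apply: val_inj; rewrite /= -tl -(behead_window s0) window_block.
split.
- have := @block_at_in _ _ s0 chi i x 0 isT; rewrite addr0 nth0 hd eqo => ->.
  by rewrite out_window ?ltn_add2r // addr0 subrK.
- by rewrite wq' eqq' eqb addSn (behead_window s0) -addrA [- _ + _]addrC addrA.
- move=> d le; rewrite block_at_out; last by lia.
  by rewrite -addrA -intS xy //; lia.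
Qed.

Lemma run x y i :
  trace (dec (window p x i)) = trace (window (L + 2 * r) y (i - r%:Z)) ->
  (forall d, (p <= d)%N -> x (i + d%:Z) = y (i + d%:Z)) ->
  forall d : nat, rsweep chi i x (i + d%:Z) = f y (i + d%:Z).
Proof.
move=> eqt xy d; elim: d i x eqt xy => [|d IH] i x eqt xy;
  have [out_i eqt' xy'] := run_step eqt xy; rewrite rsweep_step.
  by rewrite addr0 rsweep_lt ?out_i //; lia.
by rewrite intS addrA IH.
Qed.

(** Whatever the initial window holds, it decodes to some word. Writing that word into [x] on [i -
    r, i + p) gives a [y] on which the run is correct, and f y agrees with f x from i + p + r on. *)
Lemma run_far x i j : i + (p + r)%:Z <= j -> rsweep chi i x j = f x j.
Proof.
move=> le; pose y : config S := fun j =>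
  if (i - r%:Z <= j) && (j < i + p%:Z)
  then nth s0 (dec (window p x i)) (absz (j - (i - r%:Z))%R) else x j.
have yx d : (p <= d)%N -> x (i + d%:Z) = y (i + d%:Z).
  by move=> le'; rewrite /y ifF //; lia.
have -> : j = i + (absz (j - i)%R)%:Z by lia.
rewrite (run _ yx); first by apply: eq_ca_map => k lek; rewrite /y ifF //; lia.
congr (trace _); apply: (@eq_from_nth _ s0) => [|k].
  by rewrite szdec size_tuple.
rewrite szdec => ltk; rewrite nth_window // /y ifT; last by lia.
by congr nth; lia.
Qed.

Lemma sweeper_of_realizes : is_sweeper f.
Proof.
exists p.+1, chi; split=> // y; apply/cvg_configP => j.
by exists (absz j + (p + r))%N => m le; rewrite run_far //; lia.
Qed.

End Run.

Section Transducer.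
Variables (m : nat) (dec : p.-tuple S -> seq S) (kap : p.-tuple S -> nat).
Variable enc : {ffun (2 * r).-tuple S * 'I_(L + 2 * r) -> S} -> nat -> p.-tuple S.
Hypothesis szdec : forall q, size (dec q) = (L + 2 * r)%N.
Hypothesis kapm : forall q, (kap q < m)%N.
Hypothesis encP : forall w k, size w = (L + 2 * r)%N -> (k < m)%N ->
  trace (dec (enc (trace w) k)) = trace w /\ kap (enc (trace w) k) = k.

(** The inert index [kap q] is carried along unchanged, so that no information is lost. *)
Definition transducer (v : p.+1.-tuple S) : p.+1.-tuple S :=
  let q := mktuple (fun k : 'I_p => nth s0 v k) in
  let u := rcons (dec q) (nth s0 v p) in
  cons_tuple (out u 0) (enc (trace (behead u)) (kap q)).

Lemma transducerE (v : p.+1.-tuple S) (q : p.-tuple S) s : v = rcons q s :> seq S ->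
  transducer v = cons_tuple (out (rcons (dec q) s) 0)
                   (enc (trace (behead (rcons (dec q) s))) (kap q)).
Proof.
move=> vE; rewrite /transducer (tuple_prefix _ vE).
by rewrite vE nth_rcons size_tuple ltnn eqxx.
Qed.

Let size_next q s : size (behead (rcons (dec q) s)) = (L + 2 * r)%N.
Proof. by rewrite size_behead size_rcons szdec. Qed.

Lemma transducer_realizes : realizes dec transducer.
Proof.
move=> v q s /transducerE ->; split=> //=.
eexists; split; first by [].
by rewrite (encP _ _).1.
Qed.

Hypothesis st : stable s0 floc L.
Hypothesis coding_inj : forall q q',
  trace (dec q) = trace (dec q') -> kap q = kap q' -> q = q'.

(** By stability the emitted letter and the new class determine the old class and the letter read;
    the inert index then determines the old state. *)
Lemma transducer_inj : injective transducer.
Proof.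
move=> v v'; have [q [s vE]] := tuple_rcons v; have [q' [s' vE']] := tuple_rcons v'.
rewrite (transducerE vE) (transducerE vE') => -[eqo eqe].
have {}eqe : enc (trace (behead (rcons (dec q) s))) (kap q) =
             enc (trace (behead (rcons (dec q') s'))) (kap q') by apply: val_inj.
have [t1 k1] := encP (size_next q s) (kapm q).
have [t2 k2] := encP (size_next q' s') (kapm q').
have eqk : kap q = kap q' by rewrite -k1 eqe k2.
have eqt : trace (behead (rcons (dec q) s)) = trace (behead (rcons (dec q') s')).
  by rewrite -t1 eqe t2.
have [|eqq eqs] := stable_rcons_inj st (szdec q) (szdec q') (s := s) (s' := s').
  by rewrite trace_behead ?size_rcons ?szdec.
by apply: val_inj; rewrite /= vE vE' eqs (coding_inj eqq eqk).
Qed.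

Hypothesis m0 : (0 < m)%N.

Lemma slider_of_transducer : is_slider f.
Proof.
have [xi chiK xiK] := injF_bij transducer_inj.
have real := transducer_realizes.
exists p.+1, transducer, xi; split=> // y z; split=> [<-|[x [i [<- <-]]]]; last first.
  (* Both sweeps are compared [n] steps to the left of [i]: far enough for the run started there to
     be correct at [j], and for the left sweep to be final on the window that f reads at [j]. *)
  apply/funext => j; pose n := (absz (j - i) + (p + r))%N.
  rewrite -(rsweep_lsteps xiK i n) (run_far szdec real); last by lia.
  apply: eq_ca_map => k lek; rewrite (@lsweepE _ _ _ _ n) //; lia.
(* [X i] is the snapshot at [i] of a run on [y]: output on the left, the code of the current class
   with inert index 0 on [i, i + p), unread input on the right. The rule carries each snapshot to
   the next. *)
pose X i : config S := fun j => if j < i then f y j else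
  if j < i + p%:Z then
    nth s0 (enc (trace (window (L + 2 * r) y (i - r%:Z))) 0) (absz (j - i)%R)
  else y j.
have szw i : size (window (L + 2 * r) y (i - r%:Z)) = (L + 2 * r)%N by rewrite size_tuple.
have Xge i d : (p <= d)%N -> X i (i + d%:Z) = y (i + d%:Z).
  by move=> le; rewrite /X !ifF //; lia.
have Xin i : window p (X i) i = enc (trace (window (L + 2 * r) y (i - r%:Z))) 0.
  apply: (@window_eqP _ s0) => k ltk; rewrite /X ifF ?ifT; try lia.
  by congr nth; lia.
have Xt i : trace (dec (window p (X i) i)) = trace (window (L + 2 * r) y (i - r%:Z)).
  by rewrite Xin (encP _ _).1.
have XS i : block_at transducer i (X i) = X (i + 1).
  have [out_i eqt Xge'] := run_step szdec real (Xt i) (Xge i).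
  apply/funext => j; have [lt|[->|gt]] : j < i \/ j = i \/ i < j by lia.
  - by rewrite block_at_out /X ?ifT //; lia.
  - by rewrite out_i /X ifT //; lia.
  have [le|le] : i + 1 + p%:Z <= j \/ j < i + 1 + p%:Z by lia.
    have -> : j = i + 1 + (absz (j - (i + 1))%R)%:Z by lia.
    by rewrite Xge' ?Xge //; lia.
  have -> : j = i + (absz (j - i)%R)%:Z by lia.
  have [k kE] : exists k, absz (j - i)%R = k.+1 by exists (absz (j - i - 1)%R); lia.
  have ltk : (k < p)%N by lia.
  rewrite kE (block_at_in s0) ?(transducerE (window_rcons s0 p (X i) i)) //=.
  rewrite Xin; have [t1 k1] := encP (szw i) m0; rewrite k1.
  have -> : i + k.+1%:Z = i + 1 + k%:Z by lia.
  rewrite -(nth_window s0 _ _ ltk) Xin; congr (nth _ (enc _ _) _).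
  have W : rcons (window (L + 2 * r) y (i - r%:Z)) (X i (i + p%:Z)) =
         window (L.+1 + 2 * r) y (i - r%:Z).
    by rewrite addSn (window_rcons s0) Xge //; congr (rcons _ (y _)); lia.
  have := trace_rcons (X i (i + p%:Z)) (szdec _) (szw i) t1.
  rewrite W trace_behead ?size_rcons ?szdec ?size_tuple // => -[_ ->].
  by rewrite addSn (behead_window s0) -addrA [- _ + _]addrC addrA.
(* Running backwards from [X 0] passes through the snapshots [X (- n)], which tend to [y]. *)
have lX n : lsteps xi 0 n (X 0) = X (- n%:Z).
  elim: n => [|n IH] //=; rewrite IH sub0r -[RHS](block_atK (- n.+1%:Z) _ chiK) XS.
  by congr (block_at _ _ (X _)); lia.
exists (X 0), 0; split; apply/funext.
  move=> j; rewrite (@lsweepE _ _ _ _ (absz j + p)%N) ?lX; last by lia.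
  by rewrite /X !ifF //; lia.
apply: (@int_split _ 0) => [j lt|d].
  by rewrite rsweep_lt // /X ifT.
exact: (run szdec real (Xt 0) (Xge 0)).
Qed.

End Transducer.

Lemma sweeper_of_ntraces : (ntraces L <= #|S| ^ p)%N -> is_sweeper f.
Proof.
move=> le; have [|dec [kap [enc [szdec kapm encP _]]]] := @trace_coding 1 isT.
  by rewrite muln1.
exact: sweeper_of_realizes szdec (transducer_realizes szdec kapm encP).
Qed.

Lemma slider_of_ntraces :
  stable s0 floc L -> (ntraces L %| #|S| ^ p)%N -> is_slider f.
Proof.
move=> st /dvdnP[m mE].
have m0 : (0 < m)%N.
  have : (0 < #|S| ^ p)%N by rewrite expn_gt0; apply/orP; left; apply/card_gt0P; exists s0.
  by rewrite mE; case: m {mE}.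
have [|dec [kap [enc [szdec kapm encP inj]]]] := trace_coding m0.
  by rewrite mE mulnC.
apply: (slider_of_transducer szdec kapm encP st _ m0); apply: inj.
by rewrite mE mulnC.
Qed.

End Realization.

(** * Bounds on the number of traces of sliders and sweepers *)

Section Widening.
Variables (S : finType) (s0 : S).
Implicit Types (x y z : config S) (i j : int).

(** Leaving one more letter untouched does not change the sweeps; this brings any block rule to a
    size p + 1 with p = L + r. *)
Definition widen n (chi : n.-tuple S -> n.-tuple S) (v : n.+1.-tuple S) : n.+1.-tuple S :=
  [tuple of rcons (chi (mktuple (fun k : 'I_n => nth s0 v k))) (nth s0 v n)].

Lemma block_at_widen n (chi : n.-tuple S -> n.-tuple S) i x :
  block_at (widen chi) i x = block_at chi i x.
Proof.
have W : mktuple (fun k : 'I_n => nth s0 (window n.+1 x i) k) = window n x i.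
  by apply: eq_mktuple => k; rewrite nth_window // ltnW // ltnS.
apply/funext => j; rewrite /block_at /widen W nth_rcons size_tuple.
have [h|[->|[h1 h2]]] : (j < i \/ i + n%:Z < j) \/ j = i + n%:Z \/ i <= j /\ j < i + n%:Z by lia.
- by rewrite !ifF //; lia.
- have -> : absz (i + n%:Z - i)%R = n by lia.
  by rewrite ltnn eqxx [RHS]ifF ?ltxx ?andbF // ifT ?nth_window //; lia.
- by rewrite !ifT //; lia.
Qed.

Lemma rsweep_widen n (chi : n.-tuple S -> n.-tuple S) i x :
  rsweep (widen chi) i x = rsweep chi i x.
Proof.
rewrite /rsweep (_ : rsteps (widen chi) i ^~ x = rsteps chi i ^~ x) //.
by apply/funext => m; elim: m => //= m ->; rewrite block_at_widen.
Qed.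

Lemma lsweep_widen n (xi : n.-tuple S -> n.-tuple S) i x :
  lsweep (widen xi) i x = lsweep xi i x.
Proof.
rewrite /lsweep (_ : lsteps (widen xi) i ^~ x = lsteps xi i ^~ x) //.
by apply/funext => m; elim: m => //= m ->; rewrite block_at_widen.
Qed.

Lemma widenE n (chi : n.-tuple S -> n.-tuple S) (v : n.+1.-tuple S) (q : n.-tuple S) s :
  v = rcons q s :> seq S -> widen chi v = rcons (chi q) s :> seq S.
Proof.
by move=> vE; rewrite /= (tuple_prefix _ vE) vE nth_rcons size_tuple ltnn eqxx.
Qed.

Lemma widenK n (chi xi : n.-tuple S -> n.-tuple S) :
  cancel chi xi -> cancel (widen chi) (widen xi).
Proof.
move=> chiK v; have [q [s vE]] := tuple_rcons v.
by apply: val_inj; rewrite /= (widenE _ (widenE chi vE)) chiK vE.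
Qed.

Variable f : config S -> config S.

Lemma slider_widen n (chi xi : n.-tuple S -> n.-tuple S) m :
  cancel chi xi -> cancel xi chi ->
  (forall y z, f y = z <-> slider_relation chi xi y z) -> (n <= m)%N ->
  exists chi' xi' : m.-tuple S -> m.-tuple S, [/\ cancel chi' xi', cancel xi' chi' &
    forall y z, f y = z <-> slider_relation chi' xi' y z].
Proof.
move=> chiK xiK fE /subnK<-; elim: (m - n)%N => [|d [chi' [xi' [K1 K2 E]]]].
  by exists chi, xi.
exists (widen chi'), (widen xi'); split; try exact: widenK.
move=> y z; rewrite E; split=> -[x [i]] H; exists x, i; move: H.
  by rewrite rsweep_widen lsweep_widen.
by rewrite rsweep_widen lsweep_widen.
Qed.

Lemma sweeper_widen n (chi : n.-tuple S -> n.-tuple S) m :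
  (forall y j, exists N, forall i : nat, (N <= i)%N -> rsweep chi (- i%:Z) y j = f y j) ->
  (n <= m)%N ->
  exists chi' : m.-tuple S -> m.-tuple S,
    forall y j, exists N, forall i : nat, (N <= i)%N -> rsweep chi' (- i%:Z) y j = f y j.
Proof.
move=> fE /subnK<-; elim: (m - n)%N => [|d [chi' E]]; first by exists chi.
exists (widen chi') => y j; have [N NE] := E y j.
by exists N => i /NE; rewrite rsweep_widen.
Qed.

End Widening.

(** * Reading classes of words off a given block rule *)

Section Necessity.
Variables (S : finType) (s0 : S) (r : nat) (floc : (2 * r).+1.-tuple S -> S) (L : nat).
Implicit Types (x y z : config S) (i j : int).

Local Notation p := (L + r)%N.
Local Notation f := (ca_map floc).
Local Notation out := (out s0 floc).
Local Notation trace := (trace s0 floc L).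
Local Notation ntraces := (ntraces s0 floc).

Let patch (w : seq S) i : config S :=
  fun j => if i <= j then nth s0 w (absz (j - i)%R) else s0.

Let patchE w i d : patch w i (i + d%:Z) = nth s0 w d.
Proof. by rewrite /patch ifT; [congr nth; lia | lia]. Qed.

Let window_patch n (w : n.-tuple S) i : window n (patch w i) i = w.
Proof. by apply: (@window_eqP _ s0) => k ltk; rewrite patchE. Qed.

Section Slider.
Variables chi xi : p.+1.-tuple S -> p.+1.-tuple S.
Hypotheses (chiK : cancel chi xi) (xiK : cancel xi chi).
Hypothesis fE : forall y z, f y = z <-> slider_relation chi xi y z.

Let f_lsweep i x : f (lsweep xi i x) = rsweep chi i x.
Proof. by apply/fE; exists x, i. Qed.

(** For the left sweep y of [x] this is y on [i - r, i + p), the stretch whose class must be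
    recoverable from the window of [x] at [i]. *)
Let past i x := window (L + 2 * r) (lsweep xi i x) (i - r%:Z).

(* The part of lsweep xi i x left of i + p ignores x on the right of i + p, and
   rsweep chi i x right of i ignores x on the left of i. *)
Lemma trace_past x x' i i' : window p x i = window p x' i' ->
  trace (past i x) = trace (past i' x').
Proof.
move=> eqw; apply/ffunP => -[c k]; rewrite !ffunE.
pose ext i (x : config S) : config S := fun j =>
  if i + p%:Z <= j then nth s0 c (absz (j - (i + p%:Z))%R) else x j.
(* Writing [c] from i + p on does not affect [past], so the outputs of [past] followed by [c] are
   read off a right sweep that depends only on the window and on [c]. *)
have H i1 x1 : out (past i1 x1 ++ c) k = rsweep chi i1 (ext i1 x1) (i1 + k%:Z).
  have ext_lt j : j < i1 + p%:Z -> ext i1 x1 j = x1 j by move=> lt; rewrite /ext ifF //; lia.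
  rewrite -f_lsweep.
  rewrite (_ : past i1 x1 = window (L + 2 * r) (lsweep xi i1 (ext i1 x1)) (i1 - r%:Z)); last first.
    apply: eq_window => d ltd; apply: eq_lsweep; last by lia.
    by move=> j /ext_lt.
  rewrite (@out_cat_window _ _ _ _ _ (2 * r)).
  - by congr (f _ _); lia.
  - by have := ltn_ord k; lia.
  - move=> d ltd; rewrite lsweep_ge; last by lia.
    by rewrite /ext ifT; [congr nth; lia | lia].
rewrite /= !H; apply: eq_rsweep => d; rewrite /ext.
have -> : (i + p%:Z <= i + d%:Z) = (p <= d)%N by lia.
have -> : (i' + p%:Z <= i' + d%:Z) = (p <= d)%N by lia.
case: leqP => [le|lt]; first by congr nth; lia.
by have := congr1 (fun v => nth s0 (tval v) d) eqw; rewrite !nth_window.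
Qed.

Let state_trace (q : p.-tuple S) := trace (past 0 (patch q 0)).

Let trace_pastE i x : trace (past i x) = state_trace (window p x i).
Proof. by apply: trace_past; rewrite window_patch. Qed.

(** A configuration containing [w] has an image under f, hence is a left sweep, which may be taken
    to start at 0. *)
Let state_trace_surj (w : (L + 2 * r).-tuple S) : exists q, state_trace q = trace w.
Proof.
pose y := patch w (0 - r%:Z).
have /fE[x [i [ly _]]] : f y = f y by [].
have [x' E] := lsweep_recenter chiK i x.
exists (window p x' 0); rewrite -trace_pastE /past E ly; congr (trace (tval _)).
exact: window_patch.
Qed.

(** The transition of [chi] on states induces the transition on classes: emit the first output and
    drop the first letter. *)
Let state_trace_step (q : p.-tuple S) s w : size w = (L + 2 * r)%N ->
  state_trace q = trace w ->
  head s0 (chi (rcons_tuple q s)) = out (rcons w s) 0 /\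
  state_trace (behead_tuple (chi (rcons_tuple q s))) = trace (behead (rcons w s)).
Proof.
move=> szw eqt; pose x := patch (rcons q s) 0.
have szp i1 x1 : size (past i1 x1) = (L + 2 * r)%N by rewrite size_tuple.
have xE : window p.+1 x 0 = rcons_tuple q s by apply: (window_patch (rcons_tuple q s)).
have xq : window p x 0 = q.
  apply: (@window_eqP _ s0) => k ltk.
  by rewrite /x patchE nth_rcons size_tuple ltk.
have eqx : lsweep xi 0 x = lsweep xi 1 (block_at chi 0 x).
  by rewrite -[1]add0r (lsweep_succ chiK).
have W : rcons (past 0 x) s = window (L.+1 + 2 * r) (lsweep xi 0 x) (0 - r%:Z).
  rewrite addSn window_rcons //; congr rcons.
  have -> : 0 - r%:Z + (L + 2 * r)%:Z = 0 + p%:Z by lia.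
  by rewrite lsweep_ge ?lexx // /x patchE nth_rcons size_tuple ltnn eqxx.
have : trace (past 0 x) = trace w by rewrite trace_pastE xq.
move=> /(trace_rcons s (szp _ _) szw).
rewrite trace_behead ?size_rcons ?szw ?szp // W => -[<- <-]; split.
- rewrite out_window ?ltn_add2r // addr0 subrK f_lsweep rsweep_step.
  rewrite rsweep_lt ?add0r //.
  have := @block_at_in _ _ s0 chi 0 x 0 isT; rewrite addr0 => ->.
  by rewrite xE nth0.
- rewrite addSn (behead_window s0) eqx.
  have -> : 0 - r%:Z + 1 = 1 - r%:Z by lia.
  rewrite -/(past 1 _) trace_pastE; congr state_trace; apply: val_inj => /=.
  by rewrite -xE -window_block (behead_window s0) add0r.
Qed.

(** Given a letter [a] and a class, take a state [q'] of that class and apply [xi] to [a] followed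
    by [q']. The result is a state and a letter from which the required word is read off. *)
Lemma slider_stable : stable s0 floc L.
Proof.
move=> a w szw.
have [q' q'E] := state_trace_surj (tcast szw (in_tuple w)).
have [q [s vE]] := tuple_rcons (xi (cons_tuple a q')).
have {}vE : xi (cons_tuple a q') = rcons_tuple q s by apply: val_inj.
have [|hd tl] := @state_trace_step q s (past 0 (patch q 0)) _ erefl.
  by rewrite size_tuple.
exists (rcons (past 0 (patch q 0)) s); rewrite size_rcons size_tuple; split=> //.
  by rewrite -hd -vE xiK.
rewrite -tl -vE xiK -[w in RHS](val_tcast szw (in_tuple w)) -q'E.
by congr state_trace; apply: val_inj.
Qed.

Let fiber t := #|[set q | state_trace q == t]|.

(** For fixed [s] the emitted letter is constant on a fiber, so injectivity of [chi] makes the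
    passage to the next state injective there. *)
Let fiber_step w s : size w = (L + 2 * r)%N ->
  (fiber (trace w) <= fiber (trace (behead (rcons w s))))%N.
Proof.
move=> szw; pose g (q : p.-tuple S) := behead_tuple (chi (rcons_tuple q s)).
have injg : {in [set q | state_trace q == trace w] &, injective g}.
  move=> q q'; rewrite !inE => /eqP eq1 /eqP eq2 eqg.
  have [hd1 _] := state_trace_step s szw eq1.
  have [hd2 _] := state_trace_step s szw eq2.
  have /(can_inj chiK) : chi (rcons_tuple q s) = chi (rcons_tuple q' s).
    apply: val_inj; move: hd1 hd2 (congr1 val eqg); rewrite /=.
    case: (chi _) (chi _) => [[|a u] //= _] [[|a' u'] //= _].
    by move=> -> -> ->.
  move=> /(congr1 val) /= /rcons_inj[eqq]; exact: val_inj.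
rewrite /fiber -(card_in_imset injg); apply: subset_leq_card.
apply/subsetP => _ /imsetP[q qt ->]; move: qt; rewrite !inE => /eqP eqq; apply/eqP.
exact: (state_trace_step s szw eqq).2.
Qed.

(** Appending the letters of [w'] and dropping as many in front leads from [w] to [w'], and no step
    decreases the fiber. As [w] and [w'] are arbitrary, all fibers of classes have the same size. *)
Let fiber_le (w w' : (L + 2 * r).-tuple S) : (fiber (trace w) <= fiber (trace w'))%N.
Proof.
have H (c : seq S) : exists2 u, size u = (L + 2 * r)%N &
    drop (size c) (w ++ c) = u /\ (fiber (trace w) <= fiber (trace u))%N.
  elim/last_ind: c => [|c s [u szu [dE le]]].
    by exists w; rewrite ?size_tuple // cats0 drop0.
  exists (behead (rcons u s)); first by rewrite size_behead size_rcons szu.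
  split; last by apply: leq_trans le (fiber_step _ szu).
  by rewrite size_rcons -add1n -drop_drop drop1 -rcons_cat drop_rcons ?size_cat ?leq_addl // dE.
have [u szu [dE le]] := H w'; congr (_ <= fiber (trace _))%N: le.
by rewrite -dE drop_size_cat // !size_tuple.
Qed.

Lemma slider_dvdn : (ntraces L %| #|S| ^ p)%N.
Proof.
rewrite -card_tuple -cardsT -sum1_card.
rewrite (partition_big state_trace (mem (traces s0 floc L [set: _]))) /=; last first.
  by move=> q _; apply/tracesP; exists (past 0 (patch q 0)); rewrite size_tuple inE.
pose w0 : (L + 2 * r).-tuple S := [tuple of nseq (L + 2 * r) s0].
rewrite (eq_bigr (fun=> fiber (trace w0))) => [|t /imsetP[w _ ->]].
  by rewrite sum_nat_const dvdn_mulr.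
have -> : \sum_(q in [set: _] | state_trace q == trace w) 1 = fiber (trace w).
  by rewrite sum1dep_card /fiber; congr #|pred_of_set _|; apply/setP => q; rewrite !inE.
by apply/eqP; rewrite eqn_leq !fiber_le.
Qed.

End Slider.

(** A start [-M] early enough for the finitely many configurations and coordinates involved is
    fixed. On reaching 0, the sweep has left in [0, p) a word depending on [w] alone; with [c] it
    determines the outputs from 0 on, so it determines the trace of [w]. *)
Lemma sweeper_ntraces (chi : p.+1.-tuple S -> p.+1.-tuple S) :
  (forall y j, exists N, forall i : nat, (N <= i)%N -> rsweep chi (- i%:Z) y j = f y j) ->
  (ntraces L <= #|S| ^ p)%N.
Proof.
move=> fE; pose W := (L + 2 * r).-tuple S; pose C := (2 * r).-tuple S.
(* [w] occupies [-r, p) and [c] starts at [p], so output number [k] belongs to coordinate [k]. *)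
pose y (w : W) (c : C) := patch (w ++ c) (0 - r%:Z).
have /choice[N NE] : forall k : W * C * 'I_(L + 2 * r), exists N, forall m, (N <= m)%N ->
    rsweep chi (- m%:Z) (y k.1.1 k.1.2) k.2%:Z = f (y k.1.1 k.1.2) k.2%:Z.
  move=> k; have [N NE] := fE (y k.1.1 k.1.2) k.2%:Z.
  by exists N.
pose M := \max_k N k.
have {NE}E w c (k : 'I_(L + 2 * r)) : rsweep chi (- M%:Z) (y w c) k%:Z = f (y w c) k%:Z.
  by apply: (NE (w, c, k)); apply: leq_bigmax.
pose X w c := rsteps chi (- M%:Z) M (y w c).
pose c0 : C := [tuple of nseq (2 * r) s0].
have swX w c : rsweep chi (- M%:Z) (y w c) = rsweep chi 0 (X w c).
  by rewrite -(rsweep_rsteps chi (- M%:Z) M) addNr.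
have yr w c d : y w c (p + d)%:Z = nth s0 c d.
  have -> : (p + d)%:Z = 0 - r%:Z + (L + 2 * r + d)%:Z by lia.
  by rewrite /y patchE nth_cat size_tuple ltnNge leq_addr addKn.
have Xge w c d : X w c (p + d)%:Z = nth s0 c d by rewrite /X rsteps_ge ?yr //; lia.
have Xlt w c j : j < p%:Z -> X w c j = X w c0 j.
  move=> lt; apply: eq_rsteps_lt; last by lia.
  move=> j' lt'; rewrite /y /patch; case: ifP => // h; rewrite !nth_cat !size_tuple !ifT //; lia.
pose enc (w : W) := window p (X w c0) 0.
have [|le _] := @imset_factor _ _ _ [set: W] enc (fun w => trace w); last first.
  apply: leq_trans (leq_trans le _); last by rewrite -card_tuple max_card.
  by apply: subset_leq_card; apply/subsetP => t /imsetP[w _ ->]; apply: imset_f; rewrite inE.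
move=> w w' _ _ eqe; apply/ffunP => -[c k]; rewrite !ffunE /=.
have H (v : W) : out (v ++ c) k = rsweep chi 0 (X v c) k%:Z.
  have wE : window (L + 2 * r) (y v c) (0 - r%:Z) = v.
    by apply: (@window_eqP _ s0) => d ltd; rewrite /y patchE nth_cat size_tuple ltd.
  rewrite -swX E -wE (@out_cat_window _ s0 _ _ _ (2 * r) (y v c)).
  - by rewrite wE; congr (f _ _); lia.
  - by have := ltn_ord k; lia.
  - by move=> d _; rewrite /y patchE nth_cat size_tuple ltnNge leq_addr addKn.
rewrite !H -[k%:Z]add0r; apply: eq_rsweep => d; rewrite add0r.
have [lt|ge] := ltnP d p; last by rewrite -(subnKC ge) !Xge.
rewrite Xlt // [RHS]Xlt //.
by have := congr1 (fun v => nth s0 (tval v) d) eqe; rewrite !nth_window // add0r.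
Qed.

End Necessity.

(** * Effective characterizations *)

(** One more than the degree of the recurrence, that is, the size of its polynomial. *)
Definition bound k r := (2 ^ (k ^ (2 * r))).+1.

(* q = \sum_j (u_j - v_j) X^j satisfies q(k) > 0 and makes (q N)_L geometric of
   ratio k, so that k^r q(k) <= (q N)_0 bounds the limit of N_L / k^L below by
   k^r.  Since N_L / k^L is nonincreasing, N_B > k^(B + r) excludes the remaining
   case where this limit is reached. *)
Definition certificate (k r B : nat) (N u v : nat -> nat) : bool :=
  [&& k ^ (B + r) < N B,
      \sum_(j < B) v j * k ^ j < \sum_(j < B) u j * k ^ j,
      k ^ r * (\sum_(j < B) u j * k ^ j) + \sum_(j < B) v j * N j <=
        k ^ r * (\sum_(j < B) v j * k ^ j) + \sum_(j < B) u j * N j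
    & [forall L : 'I_B, \sum_(j < B) u j * N (L.+1 + j) + k * \sum_(j < B) v j * N (L + j) ==
                        \sum_(j < B) v j * N (L.+1 + j) + k * \sum_(j < B) u j * N (L + j)]]%N.

Lemma PoszX m n : Posz (m ^ n)%N = Posz m ^+ n.
Proof. by rewrite -!natz natrX. Qed.

(** * Soundness and completeness of certificates *)

Section Certificate.
Variables (k r B : nat) (N : nat -> nat) (P : {poly int}).
Hypotheses (k0 : (0 < k)%N) (NS : forall L, (N L.+1 <= k * N L)%N).
Hypotheses (Pm : P \is monic) (szP : size P = B) (PN : forall L, act P (fun L => Posz (N L)) L = 0).
Let NZ L := Posz (N L).

Let NZ_S L : NZ L.+1 <= k%:Z * NZ L. Proof. by rewrite -PoszM lez_nat. Qed.

Let B0 : (0 < B)%N. Proof. by rewrite -szP size_poly_gt0 monic_neq0. Qed.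

Let hornerE (q : {poly int}) u v : (size q <= B)%N ->
  (forall j, (j < B)%N -> q`_j = (u j)%:Z - (v j)%:Z) ->
  q.[k%:Z] = (\sum_(j < B) u j * k ^ j)%N%:Z - (\sum_(j < B) v j * k ^ j)%N%:Z.
Proof.
move=> szq qE; rewrite (horner_coef_wide _ szq) !(big_morph Posz PoszD (erefl _)) -sumrB.
by apply: eq_bigr => j _; rewrite qE // !PoszM -mulrBl PoszX.
Qed.

Let actE (q : {poly int}) u v L : (size q <= B)%N ->
  (forall j, (j < B)%N -> q`_j = (u j)%:Z - (v j)%:Z) ->
  act q NZ L = (\sum_(j < B) u j * N (L + j))%N%:Z - (\sum_(j < B) v j * N (L + j))%N%:Z.
Proof.
move=> szq qE; rewrite (act_widen _ _ szq) !(big_morph Posz PoszD (erefl _)) -sumrB.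
by apply: eq_bigr => j _; rewrite qE // !PoszM -mulrBl.
Qed.

Let act0E (q : {poly int}) u v : (size q <= B)%N ->
  (forall j, (j < B)%N -> q`_j = (u j)%:Z - (v j)%:Z) ->
  act q NZ 0 = (\sum_(j < B) u j * N j)%N%:Z - (\sum_(j < B) v j * N j)%N%:Z.
Proof. exact: actE. Qed.

Let powE i : k%:Z ^+ r * k%:Z ^+ i = (k ^ (i + r))%N%:Z.
Proof. by rewrite -exprD addnC PoszX. Qed.

Lemma certificate_sound u v : certificate k r B N u v -> forall L, (k ^ (L + r) < N L)%N.
Proof.
move=> /and4P[NB qk qle /forallP qS].
pose q : {poly int} := \poly_(j < B) ((u j)%:Z - (v j)%:Z).
have szq : (size q <= B)%N by apply: size_poly.
have qE j : (j < B)%N -> q`_j = (u j)%:Z - (v j)%:Z by move=> lt; rewrite coef_poly lt.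
have geo L : act q NZ L.+1 = k%:Z * act q NZ L.
  apply/eqP; rewrite -subr_eq0 -actXsubC -actM; apply/eqP; rewrite actM.
  (* The defect (X - k) q N is itself annihilated by [P], so the finitely many values checked by the
     certificate force it to vanish everywhere. *)
  apply: (@act_eq0_init _ P _ B.-1); rewrite ?prednK //.
    by move=> i; rewrite -!actM -?mulrA (act_act0 _ PN).
  move=> i lti; rewrite actXsubC !(actE _ szq qE).
  have lti' : (i < B)%N by apply: leq_trans lti (leq_pred _).
  by have /eqP := qS (Ordinal lti') => /= /(congr1 Posz); rewrite !PoszD !PoszM; lia.
have q0 : 0 < q.[k%:Z] by rewrite (hornerE szq qE); lia.
have qle' : k%:Z ^+ r * q.[k%:Z] <= act q NZ 0.
  by rewrite (hornerE szq qE) (act0E szq qE) -PoszX; lia.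
move=> L; have := @above_limit k NZ k0 _ NZ_S P q (k%:Z ^+ r) B.-1 B Pm _ _ PN geo q0 qle' _ L.
by rewrite !powE !ltz_nat; apply; rewrite ?prednK.
Qed.

Lemma certificate_complete : (forall L, (k ^ (L + r) < N L)%N) ->
  exists u v, certificate k r B N u v.
Proof.
move=> kN; have [q [szq q0 geo]] : exists q : {poly int}, [/\ (size q <= size P)%N,
    0 < q.[k%:Z] & forall L, act q NZ L.+1 = k%:Z * act q NZ L].
  by apply: geometric_act_exists => //; rewrite monic_neq0.
pose u j := if 0 <= q`_j then absz q`_j else 0%N.
pose v j := if 0 <= q`_j then 0%N else absz q`_j.
rewrite szP in szq.
have qE j : (j < B)%N -> q`_j = (u j)%:Z - (v j)%:Z by rewrite /u /v; case: ifP; lia.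
exists u, v; apply/and4P; split; first exact: kN.
- by move: q0; rewrite (hornerE szq qE); lia.
- have : k%:Z ^+ r * q.[k%:Z] <= act q NZ 0.
    apply: (@limit_lower_bound k NZ) => // L.
    by rewrite powE ltz_nat.
  by rewrite (hornerE szq qE) (act0E szq qE) -PoszX; lia.
- apply/forallP => L; apply/eqP; have := geo L; rewrite !(actE _ szq qE); lia.
Qed.

End Certificate.

Section Characterizations.
Variables (S : finType) (s0 : S) (r : nat) (floc : (2 * r).+1.-tuple S -> S).
Local Notation f := (ca_map floc).
Local Notation N := (ntraces s0 floc).
Local Notation B := (bound #|S| r).

Let k0 : (0 < #|S|)%N. Proof. by apply/card_gt0P; exists s0. Qed.

Lemma ntraces_growth L m : stable s0 floc L -> N (L + m) = (#|S| ^ m * N L)%N.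
Proof.
move=> st; have stm j : stable s0 floc (L + j).
  by elim: j => [|j IH]; rewrite ?addn0 // addnS; apply: stable_S.
elim: m => [|m IH]; first by rewrite addn0 mul1n.
by rewrite addnS (stableP _ _ _).1 // IH expnS mulnA.
Qed.

(** Stability persists, so the sequence k N_L - N_(L+1) is eventually zero. It satisfies the
    recurrence, hence vanishes from the degree of [P] on, in particular at [B]. *)
Lemma stable_bound L : stable s0 floc L -> stable s0 floc B.
Proof.
move=> st; have [P [Pm szP PN]] := ntraces_recurrence s0 floc.
pose a L := #|S|%:Z * Posz (N L) - Posz (N L.+1).
have a0 i : (L <= i)%N -> a i = 0.
  move=> /subnKC<-; rewrite /a -addnS !ntraces_growth // expnS -mulnA PoszM; lia.
apply/stableP; have : a B = 0; last by rewrite /a -PoszM; lia.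
apply: (@act_eventually0 _ P a _ L _ _ _ a0 _ (leqnSn _)); rewrite ?szP ?monic_neq0 //.
by move=> i; rewrite act_sub act_scale (act_shift P (fun i => Posz (N i))) !PN mulr0 subr0.
Qed.

Lemma slider_iff : is_slider f <-> N B.+1 = (#|S| * N B)%N /\ (N B %| #|S| ^ (B + r))%N.
Proof.
split=> [[n [chi [xi [n0 chiK xiK fE]]]]|[st dv]]; last first.
  by apply: slider_of_ntraces dv; apply/stableP.
have le : (n <= (n + B + r).+1)%N by rewrite ltnW // ltnS -addnA leq_addr.
have [chi1 [xi1 [K1 K2 fE1]]] := slider_widen s0 chiK xiK fE le.
have st := stable_bound (slider_stable s0 K1 K2 fE1).
split; first exact/stableP.
have := slider_dvdn s0 K1 fE1.
(* The rule was widened so that L = n + B. By stability N_L is k^n N_B, and the factor k^n cancels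
   from the divisibility. *)
rewrite [(n + B)%N]addnC ntraces_growth // addnAC expnD [X in (_ %| X)%N]mulnC.
by rewrite dvdn_pmul2l // expn_gt0 k0.
Qed.

Lemma sweeper_iff : is_sweeper f <-> exists L, (N L <= #|S| ^ (L + r))%N.
Proof.
split=> [[n [chi [n0 fE]]]|[L le]]; last exact: sweeper_of_ntraces le.
have fE' y j : exists M, forall i : nat, (M <= i)%N -> rsweep chi (- i%:Z) y j = f y j.
  by have /cvg_configP := fE y; apply.
have [chi' fE1] := sweeper_widen s0 fE' (leq_trans (leq_addr r n) (leqnSn _)).
by exists n; apply: sweeper_ntraces fE1.
Qed.

Lemma not_sweeper_certificate : ~ is_sweeper f ->
  exists u v, certificate #|S| r B N u v.
Proof.
have [P [Pm szP PN]] := ntraces_recurrence s0 floc.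
move=> ns; apply: (@certificate_complete _ _ _ _ P) => //; first exact: ntraces_S_le.
by move=> L; rewrite ltnNge; apply/negP => le; apply: ns; apply/sweeper_iff; exists L.
Qed.

Lemma certificate_not_sweeper u v : certificate #|S| r B N u v -> ~ is_sweeper f.
Proof.
have [P [Pm szP PN]] := ntraces_recurrence s0 floc.
move=> c /sweeper_iff[L]; rewrite leqNgt => /negP; apply.
exact: (@certificate_sound _ _ _ _ P k0 (ntraces_S_le s0 floc) Pm szP PN u v c).
Qed.

End Characterizations.

(** * Recursive functions *)

Local Open Scope nat_scope.

(** Programs carry no arity: [n] fixes the length of the argument lists that count. *)
Definition computable n (F : seq nat -> nat) :=
  exists p, forall s, size s = n -> computes p s (F s).

Section Computable.
Implicit Types (F G a b : seq nat -> nat) (s : seq nat).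

Lemma computable_ext n F G :
  (forall s, size s = n -> F s = G s) -> computable n F -> computable n G.
Proof. by move=> FG [p pF]; exists p => s szs; rewrite -FG //; apply: pF. Qed.

Lemma computable_nth n i : i < n -> computable n (fun s => nth 0 s i).
Proof. by move=> lt; exists (RProj i) => s szs; apply: computes_proj; rewrite szs. Qed.

Lemma computable_comp n F (Gs : seq (seq nat -> nat)) :
  computable (size Gs) F -> (forall i, i < size Gs -> computable n (nth (fun=> 0) Gs i)) ->
  computable n (fun s => F [seq G s | G <- Gs]).
Proof.
move=> [p pF] GsP.
have [ps [szps psP]] : exists ps, size ps = size Gs /\ forall s, size s = n ->
    forall i, i < size Gs -> computes (nth RZero ps i) s (nth (fun=> 0) Gs i s).
  elim: Gs GsP {pF} => [|G Gs IH] GsP; first by exists [::].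
  have [q qG] := GsP 0 isT; have [|ps [szps psP]] := IH; first by move=> i; apply: (GsP i.+1).
  exists (q :: ps); rewrite /= szps; split=> // s szs [|i] lti; first exact: qG.
  exact: psP.
exists (RComp p ps) => s szs.
apply: (@computes_comp _ _ _ [seq G s | G <- Gs]); first by rewrite size_map.
- by move=> i; rewrite szps => lti; rewrite (nth_map (fun=> 0)) //; apply: psP.
- by apply: pF; rewrite size_map.
Qed.

Lemma computable_select n m F (l : seq nat) :
  computable n F -> size l = n -> all (fun i => i < m) l ->
  computable m (fun s => F [seq nth 0 s i | i <- l]).
Proof.
move=> cF szl /allP lm.
pose Gs := [seq (fun s => nth 0 s i) | i <- l].
apply: (@computable_ext _ (fun s => F [seq G s | G <- Gs])).
  by move=> s _; rewrite -map_comp.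
apply: computable_comp; rewrite size_map szl // => i lti.
by rewrite (nth_map 0) ?szl //; apply: computable_nth; apply: lm; rewrite mem_nth ?szl.
Qed.

Lemma map_nth_iota_drop s k m : size s = k + m -> [seq nth 0 s i | i <- iota k m] = drop k s.
Proof.
move=> szs; apply: (@eq_from_nth _ 0); rewrite size_map size_iota ?size_drop ?szs ?addKn //.
by move=> i lti; rewrite (nth_map 0) ?size_iota // nth_iota // nth_drop.
Qed.

Lemma computable_weaken n F : computable n F -> computable n.+1 (fun s => F (behead s)).
Proof.
move=> cF; have := @computable_select n n.+1 F (iota 1 n) cF (size_iota _ _).
rewrite (_ : all _ _); last by apply/allP => i; rewrite mem_iota; lia.
move=> /(_ isT); apply: computable_ext => s szs.
by rewrite map_nth_iota_drop ?drop1 // szs.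
Qed.

Lemma computable_weaken2 n F :
  computable n F -> computable n.+2 (fun s => F (behead (behead s))).
Proof. by move=> cF; apply: (computable_weaken (computable_weaken cF)). Qed.

Lemma computable_head n : computable n.+1 (fun s => head 0 s).
Proof. by apply: (computable_ext _ (@computable_nth n.+1 0 isT)) => s _; rewrite nth0. Qed.

Lemma computable_succ n a : computable n a -> computable n (fun s => (a s).+1).
Proof.
move=> [p pa]; exists (RComp RSucc [:: p]) => s szs.
apply: (@computes_comp _ _ _ [:: a s]) => // [[|//] _ /=|]; first exact: pa.
exact: computes_succ.
Qed.

Lemma computable_const n c : computable n (fun=> c).
Proof.
elim: c => [|c IH]; first by exists RZero => s _; apply: computes_zero.
exact: computable_succ.
Qed.

Lemma computable_rec n m b (step : nat -> nat -> seq nat -> nat) :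
  computable n m -> computable n b ->
  computable n.+2 (fun s => step (head 0 s) (head 0 (behead s)) (behead (behead s))) ->
  computable n (fun s => nat_rect (fun=> nat) (b s) (fun i acc => step i acc s) (m s)).
Proof.
move=> cm [pb pbP] [pst pstP].
pose F s := nat_rect (fun=> nat) (b (behead s)) (fun i acc => step i acc (behead s)) (head 0 s).
have cF : computable n.+1 F.
  exists (RRec pb pst) => -[|i s] // [szs]; rewrite /F /=.
  elim: i => [|i IH] /=; first by apply: computes_rec0; apply: pbP.
  apply: computes_recS IH _.
  by apply: (pstP [:: i, _ & s]); rewrite /= szs.
(* [F] takes the number of iterations as an additional first argument; composing with [m] and the
   projections restores [n] arguments. *)
have := @computable_comp n F (m :: [seq (fun s => nth 0 s i) | i <- iota 0 n]).
rewrite /= size_map size_iota => /(_ cF) H; apply: (computable_ext _ (H _)).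
- move=> s szs; rewrite /F /= -map_comp.
  by rewrite (eq_map (_ : _ =1 nth 0 s)) // map_nth_iota_drop ?drop0.
- move=> [|i] //= lti; rewrite (nth_map 0) ?size_iota //; apply: computable_nth.
  by rewrite nth_iota.
Qed.

Lemma computable_iter n m b (f : nat -> nat) :
  (forall k a, computable k a -> computable k (fun s => f (a s))) ->
  computable n m -> computable n b -> computable n (fun s => iter (m s) f (b s)).
Proof.
move=> cf cm cb; apply: (computable_ext _ (@computable_rec _ m b (fun _ acc _ => f acc) cm cb _)).
  by move=> s _; elim: (m s) => //= i ->.
apply: cf; exact: (computable_weaken (@computable_head n)).
Qed.

Lemma computable_add n a b :
  computable n a -> computable n b -> computable n (fun s => a s + b s).
Proof.
move=> ca cb; apply: (computable_ext _ (computable_iter (f := succn) _ cb ca)) => [s _|k c cc].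
  by rewrite iter_succn.
exact: computable_succ.
Qed.

Lemma computable_mul n a b :
  computable n a -> computable n b -> computable n (fun s => a s * b s).
Proof.
move=> ca cb; have cs := @computable_rec n a (fun=> 0) (fun _ acc s => acc + b s) ca (computable_const _ _).
apply: (computable_ext _ (cs _)).
  by move=> s _; elim: (a s) => //= i ->; rewrite mulSn addnC.
apply: computable_add; first exact: (computable_weaken (@computable_head n)).
exact: computable_weaken2.
Qed.

Lemma computable_exp n a b :
  computable n a -> computable n b -> computable n (fun s => a s ^ b s).
Proof.
move=> ca cb; have cs := @computable_rec n b (fun=> 1) (fun _ acc s => a s * acc) cb (computable_const _ _).
apply: (computable_ext _ (cs _)).
  by move=> s _; elim: (b s) => //= i ->; rewrite expnS.
apply: computable_mul; first exact: computable_weaken2.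
exact: (computable_weaken (@computable_head n)).
Qed.

Lemma computable_pred n a : computable n a -> computable n (fun s => (a s).-1).
Proof.
move=> ca; have cs := @computable_rec n a (fun=> 0) (fun i _ _ => i) ca (computable_const _ _).
apply: (computable_ext _ (cs _)); last exact: computable_head.
by move=> s _; case: (a s).
Qed.

Lemma computable_sub n a b :
  computable n a -> computable n b -> computable n (fun s => a s - b s).
Proof.
move=> ca cb; apply: (computable_ext _ (computable_iter (f := predn) _ cb ca)) => [s _|k c cc].
  by rewrite iter_predn.
exact: computable_pred.
Qed.

Definition decidable_pred n (P : seq nat -> bool) := computable n (fun s => P s : nat).

Lemma decidable_not n P : decidable_pred n P -> decidable_pred n (fun s => ~~ P s).
Proof.
move=> cP; apply: (computable_ext _ (computable_sub (computable_const n 1) cP)) => s _.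
by case: (P s).
Qed.

Lemma decidable_and n P Q :
  decidable_pred n P -> decidable_pred n Q -> decidable_pred n (fun s => P s && Q s).
Proof.
move=> cP cQ; apply: (computable_ext _ (computable_mul cP cQ)) => s _.
by rewrite mulnb.
Qed.

Lemma decidable_or n P Q :
  decidable_pred n P -> decidable_pred n Q -> decidable_pred n (fun s => P s || Q s).
Proof.
move=> cP cQ; apply: (computable_ext _ (decidable_not (decidable_and (decidable_not cP) (decidable_not cQ)))) => s _.
by rewrite negb_and !negbK.
Qed.

Lemma decidable_leq n a b :
  computable n a -> computable n b -> decidable_pred n (fun s => a s <= b s).
Proof.
move=> ca cb; apply: (computable_ext _ (computable_sub (computable_const n 1) (computable_sub ca cb))) => s _.
by rewrite -subn_eq0; case: (a s - b s).
Qed.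

Lemma decidable_eq n a b :
  computable n a -> computable n b -> decidable_pred n (fun s => a s == b s).
Proof.
move=> ca cb; apply: (computable_ext _ (decidable_and (decidable_leq ca cb) (decidable_leq cb ca))) => s _.
by rewrite eqn_leq.
Qed.

Lemma computable_sum n m (F : nat -> seq nat -> nat) :
  computable n m -> computable n.+1 (fun s => F (head 0 s) (behead s)) ->
  computable n (fun s => \sum_(i < m s) F i s).
Proof.
move=> cm cF.
have cs := @computable_rec n m (fun=> 0) (fun i acc s => acc + F i s) cm (computable_const _ _).
apply: (computable_ext _ (cs _)) => [s _|].
  by elim: (m s) => [|i IH] /=; rewrite ?big_ord0 // big_ord_recr /= IH.
apply: computable_add; first exact: (computable_weaken (@computable_head n)).
have := @computable_select n.+1 n.+2 _ (0 :: iota 2 n) cF.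
rewrite /= size_iota => /(_ erefl) H; apply: (computable_ext _ (H _)).
  by move=> [|x [|y s]] //= [szs]; rewrite -[iota 2 n]/(iota (1 + 1) n) map_nth_iota_drop //= ?drop0 ?szs.
by apply/allP => i; rewrite mem_iota; lia.
Qed.

(** A bounded quantifier holds when the number of failing indices is zero. *)
Lemma decidable_forall n m (P : nat -> seq nat -> bool) :
  computable n m -> decidable_pred n.+1 (fun s => P (head 0 s) (behead s)) ->
  decidable_pred n (fun s => [forall i : 'I_(m s), P i s]).
Proof.
move=> cm cP.
have := computable_sum (F := fun i s => ~~ P i s : nat) cm (decidable_not cP).
move=> /decidable_eq/(_ (computable_const n 0)); apply: computable_ext => s _.
congr nat_of_bool; rewrite sum_nat_eq0; apply: eq_forallb => i.
by rewrite /= eqb0 negbK.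
Qed.

Lemma sum_ltn m k : \sum_(i < m) (i < k) = minn m k.
Proof. by elim: m => [|m IH]; rewrite ?big_ord0 ?min0n // big_ord_recr /= IH; lia. Qed.

(** For positive divisors the quotient counts the positive multiples of [b] that are at most [a];
    the test [0 < b] yields the value 0 for division by zero. *)
Lemma computable_div n a b :
  computable n a -> computable n b -> computable n (fun s => a s %/ b s).
Proof.
move=> ca cb.
have cP : decidable_pred n.+1 (fun s => (0 < b (behead s)) && ((head 0 s).+1 * b (behead s) <= a (behead s))).
  apply: decidable_and; apply: decidable_leq.
  - exact: computable_const.
  - exact: computable_weaken.
  - apply: computable_mul; last exact: computable_weaken.
    by apply: computable_succ; apply: computable_head.
  - exact: computable_weaken.
apply: (computable_ext _ (computable_sum (F := fun i s => (0 < b s) && (i.+1 * b s <= a s) : nat) ca cP)).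
move=> s _; case: (posnP (b s)) => [->|b0].
  by rewrite divn0 big1.
rewrite (eq_bigr (fun i : 'I_(a s) => (i < a s %/ b s) : nat)); last first.
  by move=> i _; rewrite leq_divRL.
by rewrite sum_ltn; apply/minn_idPr; apply: leq_div.
Qed.

Lemma computable_mod n a b :
  computable n a -> computable n b -> computable n (fun s => a s %% b s).
Proof.
move=> ca cb; have := computable_sub ca (computable_mul (computable_div ca cb) cb).
by apply: computable_ext => s _; rewrite {1}(divn_eq (a s) (b s)) addKn.
Qed.

Lemma decidable_dvd n a b :
  computable n a -> computable n b -> decidable_pred n (fun s => a s %| b s).
Proof.
move=> ca cb; exact: (decidable_eq (computable_mod cb ca) (computable_const n 0)).
Qed.

End Computable.

(** * Decoding sequences and the tests on codes of automata *)

Section Programs.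

(** [CodeSeq.code (m :: s)] is 2^m (2 c + 1) with c the code of [s], so the head is the 2-adic
    valuation of a positive code. The code 0 of the empty sequence yields 0, the default value of
    [nth 0]. *)
Definition item0 c := \sum_(i < c) (2 ^ i.+1 %| c).
Definition tail_code c := c %/ 2 ^ (item0 c).+1.
Definition item c i := item0 (iter i tail_code c).

Lemma item0_cons m s : item0 (CodeSeq.code (m :: s)) = m.
Proof.
rewrite /item0 [CodeSeq.code _]/=; set c := 2 ^ m * _.
have c0 : 0 < c by rewrite muln_gt0 expn_gt0.
have logc : logn 2 c = m.
  rewrite lognM ?expn_gt0 // pfactorK // logn_coprime ?addn0 //.
  by rewrite coprime2n /= odd_double.
rewrite (eq_bigr (fun i : 'I_c => (i < m) : nat)) => [|i _]; last first.
  by rewrite pfactor_dvdn // logc.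
rewrite sum_ltn; apply/minn_idPr; rewrite /c.
by apply: leq_trans (leq_pmulr _ _) => //; rewrite ltnW // ltn_expl.
Qed.

Lemma item_code s i : item (CodeSeq.code s) i = nth 0 s i.
Proof.
have zero : item0 0 = 0 by rewrite /item0 big_ord0.
elim: s i => [|m s IH] [|i].
- by rewrite /item.
- have z : iter i.+1 tail_code 0 = 0.
    by elim: i.+1 => //= j ->; rewrite /tail_code div0n.
  by rewrite /item -[CodeSeq.code _]/0 z.
- exact: item0_cons.
- rewrite /item iterSr -[nth _ _ _]/(nth 0 s i) -IH /item; congr (item0 (iter _ _ _)).
  rewrite /tail_code item0_cons [CodeSeq.code _]/= expnSr divnMA mulKn ?expn_gt0 //.
  by rewrite divn2 /= uphalf_double.
Qed.

Lemma computable_item0 n a : computable n a -> computable n (fun s => item0 (a s)).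
Proof.
move=> ca; apply: (computable_sum (F := fun i s => 2 ^ i.+1 %| a s : nat)) => //.
apply: decidable_dvd; last exact: computable_weaken.
apply: computable_exp; first exact: computable_const.
exact/computable_succ/computable_head.
Qed.

Lemma computable_item n a i :
  computable n a -> computable n i -> computable n (fun s => item (a s) (i s)).
Proof.
move=> ca ci; apply: computable_item0; apply: computable_iter => // k b cb.
apply: computable_div => //; apply: computable_exp; first exact: computable_const.
exact/computable_succ/computable_item0.
Qed.

(** With [W] a word read as a number in base [k], this is the number of its factor of length 2r + 1
    that is followed by [j] letters. *)
Definition factor k r W j := (W %/ k ^ j) %% k ^ (2 * r).+1.

(** Items 0 and 1 of the code are the number of states and the radius; the table starts at item
    2. *)
Definition letter c W j := item c (factor (item c 0) (item c 1) W j).+2.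

Definition same_trace c L w w' :=
  let k := item c 0 in let r := item c 1 in
  [forall x : 'I_(k ^ (2 * r)), [forall j : 'I_(L + 2 * r),
    letter c (w * k ^ (2 * r) + x) j == letter c (w' * k ^ (2 * r) + x) j]].

(** Classes are counted by their least representatives. *)
Definition trace_count c L :=
  let k := item c 0 in let r := item c 1 in
  \sum_(w < k ^ (L + 2 * r)) [forall w' : 'I_w, ~~ same_trace c L w' w].

Definition slider_test c :=
  let k := item c 0 in let r := item c 1 in let B := bound k r in
  (trace_count c B.+1 == k * trace_count c B) && (trace_count c B %| k ^ (B + r)).

Definition sweeper_test c m :=
  let k := item c 0 in let r := item c 1 in trace_count c m <= k ^ (m + r).

(* The integer polynomial with coefficients m_0 - m_1, m_2 - m_3, ... is the
   certificate. *)
Definition nonsweeper_test c m :=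
  let k := item c 0 in let r := item c 1 in
  certificate k r (bound k r) (trace_count c)
    (fun j => item m (2 * j)) (fun j => item m (2 * j).+1).

Ltac comp := repeat first
  [ assumption
  | exact: computable_const
  | exact: computable_head
  | apply: computable_weaken; [idtac]
  | apply: computable_weaken2; [idtac]
  | apply: computable_item
  | apply: computable_succ
  | apply: computable_add
  | apply: computable_mul
  | apply: computable_exp
  | apply: computable_div
  | apply: computable_mod ].

Lemma computable_factor n k r W j :
  computable n k -> computable n r -> computable n W -> computable n j ->
  computable n (fun s => factor (k s) (r s) (W s) (j s)).
Proof. by move=> ck cr cW cj; rewrite /factor; comp. Qed.

Lemma computable_letter n c W j : computable n c -> computable n W -> computable n j ->
  computable n (fun s => letter (c s) (W s) (j s)).
Proof.
by move=> cc cW cj; apply: computable_item; comp; apply: computable_factor; comp.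
Qed.

Lemma decidable_same_trace n c L w w' :
  computable n c -> computable n L -> computable n w -> computable n w' ->
  decidable_pred n (fun s => same_trace (c s) (L s) (w s) (w' s)).
Proof.
move=> cc cL cw cw'; pose K s := item (c s) 0 ^ (2 * item (c s) 1).
have cK : computable n K by rewrite /K; comp.
apply: (decidable_forall (P := fun x s => [forall j : 'I_(L s + 2 * item (c s) 1),
    letter (c s) (w s * K s + x) j == letter (c s) (w' s * K s + x) j])) => //.
apply: (decidable_forall (P := fun j s => let t := behead s in
    letter (c t) (w t * K t + head 0 s) j == letter (c t) (w' t * K t + head 0 s) j)).
  by comp.
by apply: decidable_eq; apply: computable_letter; comp.
Qed.

Lemma computable_trace_count n c L :
  computable n c -> computable n L -> computable n (fun s => trace_count (c s) (L s)).
Proof.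
move=> cc cL.
apply: (computable_sum (F := fun w s => [forall w' : 'I_w, ~~ same_trace (c s) (L s) w' w] : nat)).
  by comp.
apply: (decidable_forall (P := fun w' s =>
  ~~ same_trace (c (behead s)) (L (behead s)) w' (head 0 s))); first by comp.
by apply: decidable_not; apply: decidable_same_trace; comp.
Qed.

Lemma computable_bound n k r :
  computable n k -> computable n r -> computable n (fun s => bound (k s) (r s)).
Proof. by move=> ck cr; rewrite /bound; comp. Qed.

Lemma decidable_slider_test n c :
  computable n c -> decidable_pred n (fun s => slider_test (c s)).
Proof.
move=> cc; have cB : computable n (fun s => bound (item (c s) 0) (item (c s) 1)).
  by apply: computable_bound; comp.
apply: decidable_and; [apply: decidable_eq|apply: decidable_dvd];
  by comp; apply: computable_trace_count; comp.
Qed.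

Lemma decidable_sweeper_test n c m : computable n c -> computable n m ->
  decidable_pred n (fun s => sweeper_test (c s) (m s)).
Proof.
by move=> cc cm; apply: decidable_leq; comp; apply: computable_trace_count; comp.
Qed.

Lemma decidable_nonsweeper_test n c m : computable n c -> computable n m ->
  decidable_pred n (fun s => nonsweeper_test (c s) (m s)).
Proof.
move=> cc cm.
have cB : computable n (fun s => bound (item (c s) 0) (item (c s) 1)).
  by apply: computable_bound; comp.
have cS (a : nat -> nat -> nat -> nat) :
    (forall l C M J, computable l C -> computable l M -> computable l J ->
       computable l (fun s => a (C s) (M s) (J s))) ->
    computable n (fun s => \sum_(j < bound (item (c s) 0) (item (c s) 1)) a (c s) (m s) j).
  move=> ca; apply: (computable_sum (F := fun j s => a (c s) (m s) j)) => //.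
  by apply: ca; comp.
have cS1 (a : nat -> nat -> nat -> nat -> nat) :
    (forall l C M J I, computable l C -> computable l M -> computable l J -> computable l I ->
       computable l (fun s => a (C s) (M s) (J s) (I s))) ->
    computable n.+1 (fun s => \sum_(j < bound (item (c (behead s)) 0) (item (c (behead s)) 1))
      a (c (behead s)) (m (behead s)) j (head 0 s)).
  move=> ca; apply: (computable_sum (F := fun j s => a (c (behead s)) (m (behead s)) j (head 0 s))).
    by apply: computable_bound; comp.
  by apply: ca; comp.
repeat apply: decidable_and.
- apply: decidable_leq; comp; apply: computable_trace_count; comp.
- apply: decidable_leq; comp.
  + apply: (cS (fun c m j => item m (2 * j).+1 * item c 0 ^ j)) => *; comp.
  + apply: (cS (fun c m j => item m (2 * j) * item c 0 ^ j)) => *; comp.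
- apply: decidable_leq; comp.
  + apply: (cS (fun c m j => item m (2 * j) * item c 0 ^ j)) => *; comp.
  + apply: (cS (fun c m j => item m (2 * j).+1 * trace_count c j)) => *; comp.
    exact: computable_trace_count.
  + apply: (cS (fun c m j => item m (2 * j).+1 * item c 0 ^ j)) => *; comp.
  + apply: (cS (fun c m j => item m (2 * j) * trace_count c j)) => *; comp.
    exact: computable_trace_count.
- apply: (decidable_forall (P := fun L s =>
    let k := item (c s) 0 in let B := bound k (item (c s) 1) in
    let N := trace_count (c s) in
    let u j := item (m s) (2 * j) in let v j := item (m s) (2 * j).+1 in
    \sum_(j < B) u j * N (L.+1 + j) + k * \sum_(j < B) v j * N (L + j) ==
    \sum_(j < B) v j * N (L.+1 + j) + k * \sum_(j < B) u j * N (L + j))) => //.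
  apply: decidable_eq; comp.
  + apply: (cS1 (fun c m j L => item m (2 * j) * trace_count c (L.+1 + j))) => *; comp.
    by apply: computable_trace_count; comp.
  + apply: (cS1 (fun c m j L => item m (2 * j).+1 * trace_count c (L + j))) => *; comp.
    by apply: computable_trace_count; comp.
  + apply: (cS1 (fun c m j L => item m (2 * j).+1 * trace_count c (L.+1 + j))) => *; comp.
    by apply: computable_trace_count; comp.
  + apply: (cS1 (fun c m j L => item m (2 * j) * trace_count c (L + j))) => *; comp.
    by apply: computable_trace_count; comp.
Qed.

Lemma decider_of_slider_test : exists d, forall c, computes d [:: c] (slider_test c).
Proof.
have [d dP] := decidable_slider_test (@computable_head 0).
by exists d => c; apply: (dP [:: c]).
Qed.

Lemma decider_of_sweeper_tests : exists d, forall c m,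
  sweeper_test c m || nonsweeper_test c m ->
  (forall i, i < m -> ~~ (sweeper_test c i || nonsweeper_test c i)) ->
  computes d [:: c] (sweeper_test c m).
Proof.
have cm : computable 2 (fun s => head 0 s) by apply: computable_head.
have cc : computable 2 (fun s => head 0 (behead s)).
  exact: (computable_weaken (@computable_head 0)).
(* [RMu] searches for the value 0, hence the negation. *)
have [t tP] := decidable_not
  (decidable_or (decidable_sweeper_test cc cm) (decidable_nonsweeper_test cc cm)).
have [o oP] := decidable_sweeper_test cc cm.
exists (RComp o [:: RMu t; RProj 0]) => c m mT mF.
apply: (@computes_comp _ _ _ [:: m; c]) => //; last exact: (oP [:: m; c]).
case=> [|[|//]] _; last exact: (@computes_proj 0 [:: c]).
apply: (@computes_mu _ _ _ (fun=> 0)) => [|i /mF iF].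
  by have := tP [:: m; c] erefl; rewrite /= mT.
by have := tP [:: i; c] erefl; rewrite /= iF.
Qed.

End Programs.

(** * Correctness of the programs *)

(** Each value of [g] is taken at exactly one element whose number is least among those with that
    value. *)
Lemma card_imset_minimal (T U : finType) (g : T -> U) K (num : T -> 'I_K) (e : nat -> nat -> bool) :
  bijective num -> (forall w w', e (num w) (num w') = (g w == g w')) ->
  #|[set g w | w in [set: T]]| = \sum_(n < K) [forall n' : 'I_n, ~~ e n' n].
Proof.
move=> [word numK wordK] eE.
pose first n := [forall n' : 'I_n, ~~ e n' n].
pose M := [set w : T | first (num w)].
have firstP w w' : first (num w) -> first (num w') -> g w = g w' -> num w <= num w'.
  move=> /forallP fw _ eqg; rewrite leqNgt; apply/negP => lt.
  by have := fw (Ordinal lt); rewrite /= eE eqg eqxx.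
have injg : {in M &, injective g}.
  move=> w w'; rewrite !inE => fw fw' eqg; apply: (can_inj numK); apply: val_inj.
  by apply/eqP; rewrite eqn_leq !firstP.
have -> : [set g w | w in [set: T]] = g @: M.
  apply/eqP; rewrite eqEsubset; apply/andP; split; last by apply: imsetS; apply: subsetT.
  apply/subsetP => _ /imsetP[w _ ->].
  have exw : exists n, [exists w', (num w' == n :> nat) && (g w' == g w)].
    by exists (num w); apply/existsP; exists w; rewrite !eqxx.
  case: (ex_minnP exw) => n /existsP[w' /andP[/eqP nE /eqP gE]] minn.
  rewrite -gE; apply: imset_f; rewrite inE; apply/forallP => n'.
  have ltK : n' < K by rewrite (ltn_trans (ltn_ord n')) // -nE.
  apply/negP; rewrite -[n' : nat]/(val (Ordinal ltK)) -(wordK (Ordinal ltK)) eE => /eqP g'.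
  have : n <= n'.
    apply: minn; apply/existsP; exists (word (Ordinal ltK)).
    by rewrite wordK eqxx g' gE eqxx.
  by rewrite leqNgt -nE ltn_ord.
rewrite (card_in_imset injg) -sum1_card (reindex num) /=; last by exists word.
rewrite big_mkcond; apply: eq_bigr => w _.
by rewrite /M inE -/(first (num w)); case: (first _).
Qed.

(** * Words as numbers in base k *)

Section Numbering.
Variable S : finType.
Implicit Types (w u : seq S).
Local Notation k := #|S|.

Definition num w := foldl (fun n (a : S) => n * k + enum_rank a) 0 w.

Lemma num_cat w u : num (w ++ u) = num w * k ^ size u + num u.
Proof.
suff H n v : foldl (fun n (a : S) => n * k + enum_rank a) n v = n * k ^ size v + num v.
  by rewrite {1}/num foldl_cat H.
elim: v n => [|a v IH] n /=; first by rewrite muln1 /num addn0.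
rewrite /= IH -[num (a :: v)]/(foldl _ (0 * k + enum_rank a) v) IH.
by rewrite mul0n add0n mulnDl expnS mulnA addnA.
Qed.

Lemma num_cons a w : num (a :: w) = enum_rank a * k ^ size w + num w.
Proof. by rewrite -cat1s num_cat. Qed.

Lemma num_lt w : num w < k ^ size w.
Proof.
elim: w => [|a w IH] //; rewrite num_cons expnS /=.
apply: (@leq_trans ((enum_rank a).+1 * k ^ size w)).
  by rewrite mulSn addnC ltn_add2r.
by rewrite leq_mul2r ltn_ord orbT.
Qed.

Lemma num_inj w u : size w = size u -> num w = num u -> w = u.
Proof.
elim: w u => [|a w IH] [|b u] //= [szE]; rewrite !num_cons szE => eqn.
have wlt : num w < k ^ size u by rewrite -szE num_lt.
have ult := num_lt u.
have Kpos : 0 < k ^ size u by apply: leq_ltn_trans ult.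
congr cons; last first.
  by apply: IH => //; have := congr1 (modn^~ (k ^ size u)) eqn; rewrite !modnMDl !modn_small.
apply: enum_rank_inj; apply: val_inj.
by have := congr1 (divn^~ (k ^ size u)) eqn; rewrite !divnMDl // !divn_small // !addn0.
Qed.

Lemma size_words_lt m (w : m.-tuple S) : num w < k ^ m.
Proof. by rewrite -[m in k ^ m](size_tuple w) num_lt. Qed.

Definition word_index m (w : m.-tuple S) : 'I_(k ^ m) := Ordinal (size_words_lt w).

Lemma word_index_bij m : bijective (@word_index m).
Proof.
apply: inj_card_bij; last by rewrite card_ord card_tuple.
by move=> w u /(congr1 val) /= eqn; apply: val_inj; apply: num_inj eqn; rewrite !size_tuple.
Qed.

Lemma mem_words m (w : m.-tuple S) : w \in words S m.
Proof.
elim: m w => [|m IH] w; first by rewrite tuple0 inE.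
rewrite (tuple_eta w); apply/allpairsP; exists (thead w, behead_tuple w).
by rewrite mem_enum /= IH.
Qed.

(** The lexicographic list of words is ordered by number, so the table of an automaton holds the
    value at [w] in place [num w]. *)
Lemma num_words m : [seq num (tval t) | t <- words S m] = iota 0 (k ^ m).
Proof.
elim: m => [|m IH] //=; rewrite map_allpairs.
have E n : flatten [seq iota (i * k ^ m) (k ^ m) | i <- iota 0 n] = iota 0 (n * k ^ m).
  elim: n => [|n IHn] //.
  by rewrite mulSnr iotaD -IHn -[n.+1]addn1 iotaD map_cat flatten_cat /= cats0 !add0n.
rewrite expnS -E; congr flatten.
have -> : iota 0 k = [seq val (enum_rank a) | a <- enum S].
  apply: (@eq_from_nth _ 0) => [|i]; rewrite size_iota; first by rewrite size_map cardT.
  move=> lti; rewrite nth_iota // add0n (nth_map (enum_val (Ordinal lti))) -?cardT //.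
  by rewrite -[nth _ _ i]/(nth _ _ (val (Ordinal lti))) -enum_val_nth enum_valK.
rewrite -map_comp; apply: eq_map => a /=.
rewrite -[enum_rank a * _]addn0 iotaDl -IH -map_comp; apply: eq_map => t /=.
by rewrite num_cons size_tuple.
Qed.

Variables (s0 : S) (r : nat) (floc : (2 * r).+1.-tuple S -> S).

Lemma item_ca_code w : size w = (2 * r).+1 ->
  item (ca_code floc) (num w).+2 = enum_rank (out s0 floc w 0).
Proof.
move=> szw; pose v := tcast szw (in_tuple w).
have vw : tval v = w by rewrite val_tcast.
have vin := mem_words v; have lt : index v (words S (2 * r).+1) < size (words S (2 * r).+1).
  by rewrite index_mem.
have idx : index v (words S (2 * r).+1) = num w.
  have := congr1 (fun l => nth 0 l (index v (words S (2 * r).+1))) (num_words (2 * r).+1).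
  rewrite (nth_map v) // nth_index // vw nth_iota ?add0n //.
  by rewrite -(size_iota 0 (k ^ _)) -num_words size_map.
rewrite item_code /= -idx (nth_map v) // nth_index //; congr (val (enum_rank (floc _))).
apply: eq_from_tnth => i; rewrite tnth_mktuple (tnth_nth s0) vw //.
Qed.

(** The window starting at [j] in a word of length L + 2r is followed by L - 1 - j letters. *)
Lemma item_factor (w : seq S) L (j : 'I_L) : size w = L + 2 * r ->
  item (ca_code floc) (factor k r (num w) (L.-1 - j)).+2 = enum_rank (out s0 floc w j).
Proof.
move=> szw; have ltj := ltn_ord j.
pose u := take (2 * r).+1 (drop j w); pose v := drop (2 * r).+1 (drop j w).
have szu : size u = (2 * r).+1 by rewrite size_take size_drop szw; case: ltnP; lia.
have szv : size v = L.-1 - j by rewrite !size_drop szw; lia.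
have wE : w = take j w ++ u ++ v by rewrite !cat_take_drop.
have vlt : num v < k ^ (L.-1 - j) by rewrite -szv num_lt.
have ult : num u < k ^ (2 * r).+1 by rewrite -szu num_lt.
rewrite /factor {1}wE num_cat size_cat szv szu num_cat szv expnD mulnA addnA -mulnDl.
rewrite divnMDl; last by apply: leq_ltn_trans vlt.
rewrite (divn_small vlt) addn0 modnMDl (modn_small ult) item_ca_code //.
congr (val (enum_rank _)); apply: eq_out => i lei.
by rewrite add0n nth_take ?ltnS // nth_drop.
Qed.

Lemma item_ca_code0 : item (ca_code floc) 0 = k.
Proof. exact: item_code. Qed.

Lemma item_ca_code1 : item (ca_code floc) 1 = r.
Proof. exact: item_code. Qed.

Lemma same_traceE L (w w' : (L + 2 * r).-tuple S) :
  same_trace (ca_code floc) L (num w) (num w') = (trace s0 floc L w == trace s0 floc L w').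
Proof.
have E (v : (L + 2 * r).-tuple S) (c : (2 * r).-tuple S) (j : 'I_(L + 2 * r)) :
    item (ca_code floc) (factor k r (num v * k ^ (2 * r) + num c) (rev_ord j)).+2 =
    enum_rank (out s0 floc (v ++ c) j).
  rewrite -[in X in _ * X](size_tuple c) -num_cat.
  rewrite -(@item_factor _ (L + 2 * r)) ?size_cat ?size_tuple //=.
  by congr (item _ (factor _ _ _ _).+2); lia.
rewrite /same_trace /letter item_ca_code0 item_ca_code1; apply/forallP/eqP => [H|eqt x].
  apply/ffunP => -[c j]; rewrite !ffunE /=; apply: enum_rank_inj; apply: val_inj.
  by rewrite /= -!E; apply/eqP; apply: (forallP (H (word_index c))).
have [word _ wordK] := word_index_bij (2 * r).
have xE : x = num (word x) :> nat by rewrite -[in LHS](wordK x).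
apply/forallP => j; rewrite -(rev_ordK j) xE !E.
have := congr1 (fun t : {ffun _ -> S} => t (word x, rev_ord j)) eqt.
by rewrite !ffunE /= => ->.
Qed.

Lemma trace_countE L : trace_count (ca_code floc) L = ntraces s0 floc L.
Proof.
rewrite /trace_count item_ca_code0 item_ca_code1 /ntraces.
have -> : traces s0 floc L [set: (2 * r).-tuple S] =
    [set trace s0 floc L (tval w) | w in [set: (L + 2 * r).-tuple S]].
  by apply/setP => t; apply/imsetP/imsetP => -[w _ ->]; exists w; rewrite ?inE.
by rewrite (card_imset_minimal (word_index_bij _) (@same_traceE L)).
Qed.

End Numbering.

Lemma eq_certificate k r B N u v u' v' :
  (forall j, j < B -> u j = u' j /\ v j = v' j) ->
  certificate k r B N u v = certificate k r B N u' v'.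
Proof.
move=> eqc.
have eu (g : nat -> nat) : \sum_(j < B) u j * g j = \sum_(j < B) u' j * g j.
  by apply: eq_bigr => j _; rewrite (eqc j _).1.
have ev (g : nat -> nat) : \sum_(j < B) v j * g j = \sum_(j < B) v' j * g j.
  by apply: eq_bigr => j _; rewrite (eqc j _).2.
rewrite /certificate !(eu (expn k)) !(ev (expn k)) !eu !ev; congr [&& _, _, _ & _].
by apply: eq_forallb => L; rewrite !(eu (fun j => N (_ + j))) !(ev (fun j => N (_ + j))).
Qed.

(** Only the coefficients below [B] matter; [u] and [v] are interleaved at even and odd places of
    one sequence. *)
Lemma certificate_code k r B N u v : certificate k r B N u v ->
  exists m, certificate k r B N (fun j => item m (2 * j)) (fun j => item m (2 * j).+1).
Proof.
move=> uv; pose m := CodeSeq.code (mkseq (fun i => if odd i then v i./2 else u i./2) (2 * B)).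
exists m; rewrite -(@eq_certificate _ _ _ _ u v) // => j ltj.
rewrite !item_code !nth_mkseq; try lia.
by rewrite /= mul2n odd_double /= uphalf_double doubleK.
Qed.

Section Correctness.
Variables (S : finType) (r : nat) (floc : (2 * r).+1.-tuple S -> S).
Local Notation c := (ca_code floc).
Local Notation f := (ca_map floc).

(** Over an empty alphabet there are no configurations, so f is trivially a slider and a sweeper.
    The condition [0 < L] avoids 0^0 = 1 when [r = 0]. *)
Lemma trace_count_empty L : #|S| = 0 -> 0 < L -> trace_count c L = 0.
Proof.
by move=> S0 L0; rewrite /trace_count item_ca_code0 S0 exp0n ?addn_gt0 ?L0 // big_ord0.
Qed.

Let no_config : #|S| = 0 -> forall y : config S, False.
Proof. by move=> S0 y; have := fintype0 (y 0%R : S); rewrite S0. Qed.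

Lemma slider_testP : slider_test c <-> is_slider f.
Proof.
rewrite /slider_test item_ca_code0 item_ca_code1.
case: (posnP #|S|) => [S0|/card_gt0P[s0 _]].
  rewrite !trace_count_empty // S0 exp0n //; split=> // _.
  by exists 1, id, id; split=> // y; case: (no_config S0 y).
rewrite !(trace_countE s0); split=> [/andP[/eqP stN dvN]|/(slider_iff s0)[-> ->]].
  exact/(slider_iff s0).
by rewrite eqxx.
Qed.

Lemma sweeper_test_sound m : sweeper_test c m -> is_sweeper f.
Proof.
rewrite /sweeper_test item_ca_code0 item_ca_code1.
case: (posnP #|S|) => [S0 _|/card_gt0P[s0 _]].
  by exists 1, id; split=> // y; case: (no_config S0 y).
by rewrite (trace_countE s0) => le; apply/(sweeper_iff s0); exists m.
Qed.

Let trace_count_fun s0 : trace_count c = ntraces s0 floc.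
Proof. by apply/funext => L; apply: trace_countE. Qed.

Lemma nonsweeper_test_sound m : nonsweeper_test c m -> ~ is_sweeper f.
Proof.
rewrite /nonsweeper_test item_ca_code0 item_ca_code1.
case: (posnP #|S|) => [S0|/card_gt0P[s0 _]].
  by rewrite /certificate trace_count_empty // ltn0.
by rewrite (trace_count_fun s0); apply: certificate_not_sweeper.
Qed.

(** The search ends in either case: with a length having few traces if f is a sweeper, with a coded
    certificate otherwise. *)
Lemma sweeper_tests_complete : exists m, sweeper_test c m || nonsweeper_test c m.
Proof.
case: (posnP #|S|) => [S0|/card_gt0P[s0 _]].
  by exists 1; rewrite /sweeper_test trace_count_empty.
have [/(sweeper_iff s0)[L le]|ns] := pselect (is_sweeper f).
  by exists L; rewrite /sweeper_test item_ca_code0 item_ca_code1 (trace_countE s0) le.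
have [u [v /certificate_code[m mP]]] := not_sweeper_certificate s0 ns.
exists m; apply/orP; right.
by rewrite /nonsweeper_test item_ca_code0 item_ca_code1 (trace_count_fun s0).
Qed.

End Correctness.

Theorem theorem39 :
  decidable_for_ca (@is_slider) /\ decidable_for_ca (@is_sweeper).
Proof.
split.
- have [d dP] := decider_of_slider_test; exists d => S r floc.
  by have := dP (ca_code floc); rewrite -slider_testP; case: (slider_test _); split.
- have [d dP] := decider_of_sweeper_tests; exists d => S r floc.
  have [m mT mmin] := ex_minnP (sweeper_tests_complete floc).
  have := dP _ _ mT; case: (boolP (sweeper_test _ m)) mT => /= [pos _|_ neg] H.
  + split=> [_|[]]; last exact: sweeper_test_sound pos.
    by apply: H => i lti; apply/negP => /mmin; rewrite leqNgt lti.
  + split=> [sw|_]; first by case: (nonsweeper_test_sound neg).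
    by apply: H => i lti; apply/negP => /mmin; rewrite leqNgt lti.
Qed.
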